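(* Let $H=\bigoplus_{n=0}^{\infty}H_n$ be a finite-dimensional graded Hopf algebra over $\mathbb K$ with $H_0=\mathbb K G$, where $G$ is a finite abelian group. Let $\beta,\beta'\in G(H^* )$ and $g,g'\in G(H)$. If $H\bullet_{\beta}g\otimes H\bullet_{\beta'}g'$ is a simple Yetter-Drinfel'd module, then $$H\bullet_{\beta}g\otimes H\bullet_{\beta'}g'\simeq H\bullet_{\beta\beta'}gg'$$ as Yetter-Drinfel'd $H$-modules.
   Context: $\mathbb K$ is an algebraically closed field of characteristic $0$; tensor products are over $\mathbb K$. $G(C)$ denotes the set of group-like elements of a coalgebra $C$; for a finite-dimensional Hopf algebra $H$ with antipode $S$, $G(H^* )$ is the set of algebra maps $H\to\mathbb K$, with convolution product $(\beta\beta')(h)=\sum\beta(h_{(1)})\beta'(h_{(2)})$. A (left-right) Yetter-Drinfel'd $H$-module is a left $H$-module and right $H$-comodule $M$ (coaction $m\mapsto\sum m_{(0)}\otimes m_{(1)}\in M\otimes H$) such that $\sum h_{(1)}\cdot m_{(0)}\otimes h_{(2)}m_{(1)}=\sum (h_{(2)}\cdot m)_{(0)}\otimes (h_{(2)}\cdot m)_{(1)}h_{(1)}$ for all $h\in H$, $m\in M$. If $M,N$ are Yetter-Drinfel'd modules, so is $M\otimes N$ with action $h\cdot(m\otimes n)=\sum h_{(1)}\cdot m\otimes h_{(2)}\cdot n$ and coaction $m\otimes n\mapsto\sum m_{(0)}\otimes n_{(0)}\otimes n_{(1)}m_{(1)}$. For $\beta\in G(H^* )$, $H_\beta$ is the Yetter-Drinfel'd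 module with underlying space $H$, coaction $\Delta$, and action $h\bullet_\beta a=\sum\beta(h_{(2)})\,h_{(3)}\,a\,S^{-1}(h_{(1)})$. For $g\in G(H)$, $H\bullet_\beta g=\{h\bullet_\beta g: h\in H\}$ is a Yetter-Drinfel'd submodule of $H_\beta$. *)

(* Defs.v *)
From HB Require Import structures.
From mathcomp Require Import all_boot all_order all_algebra all_fingroup all_field.

Set Implicit Arguments.
Unset Strict Implicit.
Unset Printing Implicit Defensive.

Import GRing.Theory.
Local Open Scope ring_scope.

Definition mklin (K : fieldType) (U V : lmodType K) (f : U -> V) (lf : linear f) :
  {linear U -> V} := HB.pack f (GRing.isLinear.Build K U V _ f lf).

Definition mkscal (K : fieldType) (U : lmodType K) (f : U -> K) (lf : scalar f) :
  {scalar U} := HB.pack f (GRing.isLinear.Build K U K *%R f lf).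

(* The tensor product of finite-dimensional spaces: the tensor t stands for
   the sum of the e_i (x) t_i, where e is the standard basis of U.  Lemmas
   tsum_tensor, tsumE and tensor_ind give the universal property. *)
Definition tprod (K : fieldType) (U V : vectType K) : vectType K :=
  {ffun 'I_(\dim {:U}) -> V}.

Definition tensor (K : fieldType) (U V : vectType K) (u : U) (v : V) : tprod U V :=
  [ffun i => coord (vbasis {:U}) i u *: v].

Notation "u \ox v" := (tensor u v) (at level 40, left associativity) : ring_scope.

(* Sweedler sums: if t is the sum of the u_i (x) v_i and F is bilinear, then
   \tsum_(a, b <- t) F a b is the sum of the F u_i v_i. *)
Definition tsum (K : fieldType) (U V : vectType K) (W : lmodType K)
    (t : tprod U V) (F : U -> V -> W) : W :=
  \sum_(i < \dim {:U}) F (vbasis {:U})`_i ((t : {ffun 'I_(\dim {:U}) -> V}) i).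

Notation "\tsum_ ( a , b <- t ) F" := (tsum t (fun a b => F))
  (at level 41, a name, b name, t at level 200, F at level 41,
   format "\tsum_ ( a ,  b  <-  t )  F") : ring_scope.

Section TensorTheory.
Variable K : fieldType.
Implicit Types U V W X : vectType K.

Lemma tensor_linl U V (v : V) : linear (fun u : U => u \ox v).
Proof.
move=> a x y; apply/ffunP => i.
by rewrite /tensor !ffunE linearP scalerDl scalerA.
Qed.

Lemma tensor_linr U V (u : U) : linear (fun v : V => u \ox v).
Proof.
move=> a x y; apply/ffunP => i.
by rewrite /tensor !ffunE scalerDr !scalerA mulrC.
Qed.

Lemma eq_tsum U V (W : lmodType K) (F G : U -> V -> W) t :
  (forall a b, F a b = G a b) -> tsum t F = tsum t G.
Proof. by move=> eFG; apply: eq_bigr => i _; rewrite eFG. Qed.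

Lemma tsum_tensor U V (W : lmodType K) (F : U -> V -> W) u v :
  (forall b, linear (F^~ b)) -> (forall a, linear (F a)) ->
  tsum (u \ox v) F = F u v.
Proof.
move=> l1 l2; rewrite [in RHS](coord_vbasis (memvf u)).
rewrite -[F _ v]/(mklin (l1 v) _) linear_sum; apply: eq_bigr => i _.
by rewrite linearZ /= ffunE -[F _ (_ *: _)]/(mklin (l2 _) _) linearZ.
Qed.

Lemma tsumE U V (t : tprod U V) : t = \tsum_(a, b <- t) (a \ox b).
Proof.
apply/ffunP => i; rewrite sum_ffunE (bigD1 i) //= !ffunE.
have fb : free (vbasis {:U}) by apply: basis_free (vbasisP _).
rewrite (coord_free i i fb) eqxx scale1r big1 ?addr0 // => j ji.
by rewrite !ffunE (coord_free _ _ fb) (negPf ji) scale0r.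
Qed.

Lemma tsum_sum U V (W X : lmodType K) (g : W -> X) (F : U -> V -> W) t :
  linear g -> g (tsum t F) = \tsum_(a, b <- t) g (F a b).
Proof. by move=> lg; rewrite -[g _]/(mklin lg _) linear_sum. Qed.

Lemma tsum_lint U V (W : lmodType K) (F : U -> V -> W) :
  (forall a, linear (F a)) -> linear (fun t => tsum t F).
Proof.
move=> l2 a s t; rewrite /tsum scaler_sumr -big_split; apply: eq_bigr => i _ /=.
by rewrite !ffunE -[F _ _]/(mklin (l2 _) _) linearP.
Qed.

Lemma tsum_linF (T : lmodType K) U V (W : lmodType K) (F : T -> U -> V -> W) t :
  (forall a b, linear (fun x => F x a b)) -> linear (fun x => tsum t (F x)).
Proof.
move=> lF a x y; rewrite /tsum scaler_sumr -big_split; apply: eq_bigr => i _ /=.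
exact: (lF _ _).
Qed.

Lemma tsum_nest U V U' V' (W : lmodType K) (F : U' -> V' -> W)
    (G : U -> V -> tprod U' V') t : (forall a, linear (F a)) ->
  tsum (tsum t G) F = \tsum_(a, b <- t) tsum (G a b) F.
Proof. by move=> l2; rewrite -(tsum_sum _ _ (tsum_lint l2)). Qed.

Lemma tsum_tl U V U' V' (F : U -> V -> U') t (v : V') :
  tsum t F \ox v = \tsum_(a, b <- t) (F a b \ox v).
Proof. exact: (tsum_sum (g := fun u => u \ox v) _ _ (tensor_linl v)). Qed.

Lemma tsumZ U V (W : lmodType K) c (F : U -> V -> W) t :
  c *: tsum t F = \tsum_(a, b <- t) (c *: F a b).
Proof. exact: scaler_sumr. Qed.

Lemma tsum_exch U V U' V' (W : lmodType K) (F : U -> V -> U' -> V' -> W) t s :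
  \tsum_(a, b <- t) (\tsum_(c, d <- s) F a b c d) =
  \tsum_(c, d <- s) (\tsum_(a, b <- t) F a b c d).
Proof. exact: exchange_big. Qed.

Lemma tensor_ind U V (W : lmodType K) (f g : tprod U V -> W) :
  linear f -> linear g -> (forall a b, f (a \ox b) = g (a \ox b)) -> f =1 g.
Proof.
move=> lf lg fg t; rewrite (tsumE t) (tsum_sum _ _ lf) (tsum_sum _ _ lg).
by apply: eq_tsum => a b; apply: fg.
Qed.

End TensorTheory.

Record hopfAlg (K : fieldType) := HopfAlg {
  hopf_alg :> falgType K;
  comul : {linear hopf_alg -> tprod hopf_alg hopf_alg};
  counit : {lrmorphism hopf_alg -> K | *%R};
  antipode : {linear hopf_alg -> hopf_alg};
  comulA : forall h,
    \tsum_(a, b <- comul h) (\tsum_(a1, a2 <- comul a) (a1 \ox (a2 \ox b))) =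
    \tsum_(a, b <- comul h) (a \ox comul b);
  counitl : forall h, \tsum_(a, b <- comul h) (counit a *: b) = h;
  counitr : forall h, \tsum_(a, b <- comul h) (counit b *: a) = h;
  comul1 : comul 1 = 1 \ox 1;
  comulM : forall h k, comul (h * k) =
    \tsum_(a, b <- comul h) (\tsum_(c, d <- comul k) ((a * c) \ox (b * d)));
  antipodel : forall h, \tsum_(a, b <- comul h) (antipode a * b) = (counit h)%:A;
  antipoder : forall h, \tsum_(a, b <- comul h) (a * antipode b) = (counit h)%:A
}.

Arguments comul {K H} : rename.
Arguments counit {K H} : rename.
Arguments antipode {K H} : rename.

Section LinearFacts.
Variable K : fieldType.
Implicit Types T U V W : lmodType K.

Lemma lin_id U : linear (fun x : U => x). Proof. by []. Qed.

Lemma lin_comp T U V (g : U -> V) (f : T -> U) :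
  linear g -> linear f -> linear (fun x => g (f x)).
Proof. by move=> lg lf a x y; rewrite lf lg. Qed.

Lemma lin_app T U V (g : {linear U -> V}) (f : T -> U) :
  linear f -> linear (fun x => g (f x)).
Proof. by move=> lf a x y; rewrite lf linearP. Qed.

Lemma lin_ml T (A : algType K) (f : T -> A) b :
  linear f -> linear (fun x => f x * b).
Proof. by move=> lf a x y; rewrite lf mulrDl scalerAl. Qed.

Lemma lin_mr T (A : algType K) (f : T -> A) b :
  linear f -> linear (fun x => b * f x).
Proof. by move=> lf a x y; rewrite lf mulrDr scalerAr. Qed.

Lemma lin_sl T U V (g : {scalar U}) (f : T -> U) (v : V) :
  linear f -> linear (fun x => g (f x) *: v).
Proof. by move=> lf a x y; rewrite lf linearP scalerDl scalerA. Qed.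

Lemma lin_sr T U (f : T -> U) (c : K) : linear f -> linear (fun x => c *: f x).
Proof. by move=> lf a x y; rewrite lf scalerDr !scalerA mulrC. Qed.

Lemma lin_tl T (U V : vectType K) (f : T -> U) (v : V) :
  linear f -> linear (fun x => f x \ox v).
Proof. by move=> lf; apply: (lin_comp (tensor_linl v) lf). Qed.

Lemma lin_tr T (U V : vectType K) (f : T -> V) (u : U) :
  linear f -> linear (fun x => u \ox f x).
Proof. by move=> lf; apply: (lin_comp (tensor_linr u) lf). Qed.

Lemma lin_tsum T (U V : vectType K) W (F : U -> V -> W) (f : T -> tprod U V) :
  (forall a, linear (F a)) -> linear f -> linear (fun x => tsum (f x) F).
Proof. by move=> lF lf; apply: (lin_comp (tsum_lint lF) lf). Qed.

End LinearFacts.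

(* lin proves that a function built from Sweedler sums is linear in its argument;
   lin_hook is redefined when new linear operations are introduced. *)
Ltac lin_hook := fail.

Ltac lin :=
  lazymatch goal with
  | |- forall _, _ => intro; lin
  | |- _ = _ => done
  | |- _ => cbv beta; first
    [ assumption | solve [auto 2 with nocore]
    | match goal with
      | L : GRing.linear_for _ ?G |- GRing.linear_for _ (fun x => ?G (@?F x)) =>
          apply: (lin_comp (g := G) (f := F) L); lin
      | L : forall z, GRing.linear_for _ (?G z)
          |- GRing.linear_for _ (fun x => ?G ?a (@?F x)) =>
          apply: (lin_comp (g := G a) (f := F) (L a)); lin
      | L : forall z, GRing.linear_for _ (fun x => ?G x z)
          |- GRing.linear_for _ (fun x => ?G (@?F x) ?a) =>
          apply: (lin_comp (g := fun y => G y a) (f := F) (L a)); lin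
      | L : forall y z, GRing.linear_for _ (?G y z)
          |- GRing.linear_for _ (fun x => ?G ?a ?b (@?F x)) =>
          apply: (lin_comp (g := G a b) (f := F) (L a b)); lin
      | L : forall y z, GRing.linear_for _ (fun x => ?G y x z)
          |- GRing.linear_for _ (fun x => ?G ?a (@?F x) ?b) =>
          apply: (lin_comp (g := fun y => G a y b) (f := F) (L a b)); lin
      | L : forall y z, GRing.linear_for _ (fun x => ?G x y z)
          |- GRing.linear_for _ (fun x => ?G (@?F x) ?a ?b) =>
          apply: (lin_comp (g := fun y => G y a b) (f := F) (L a b)); lin
      end
    | exact: lin_id | lin_hook; lin
    | apply: lin_tl; lin | apply: lin_tr; lin
    | apply: lin_tsum; lin | apply: tsum_linF; lin
    | apply: lin_sl; lin | apply: lin_sr; lin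
    | apply: lin_ml; lin | apply: lin_mr; lin
    | apply: lin_app; lin ]
  end.

(* Coassociativity in the form in which Sweedler notation uses it. *)
Lemma tsum3 (K : fieldType) (U V U' V' W : vectType K) (X : lmodType K)
    (s : tprod U V) (f : U -> tprod U' V') (s' : tprod U' W) (g : W -> tprod V' V)
    (F : U' -> V' -> V -> X) :
  \tsum_(a, b <- s) (\tsum_(c, d <- f a) (c \ox (d \ox b))) =
    \tsum_(a, b <- s') (a \ox g b) ->
  (forall b c, linear (fun a => F a b c)) -> (forall a c, linear (fun b => F a b c)) ->
  (forall a b, linear (F a b)) ->
  \tsum_(a, b <- s) (\tsum_(c, d <- f a) F c d b) =
    \tsum_(a, b <- s') (\tsum_(c, d <- g b) F a c d).
Proof.
move=> eq_s l1 l2 l3.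
pose G (t : tprod U' (tprod V' V)) := \tsum_(a, u <- t) (\tsum_(b, c <- u) F a b c).
have lG : linear G by rewrite /G; lin.
have GE a b c : G (a \ox (b \ox c)) = F a b c.
  by rewrite /G tsum_tensor; [rewrite tsum_tensor; lin|lin|lin].
transitivity (G (\tsum_(a, b <- s') (a \ox g b))).
  rewrite -eq_s tsum_sum //; apply: eq_tsum => a b.
  by rewrite tsum_sum //; apply: eq_tsum => c d; rewrite GE.
rewrite tsum_sum //; apply: eq_tsum => a b.
by rewrite /G tsum_tensor; lin.
Qed.

Section Convolution.
Variables (K : fieldType) (C A : vectType K).
Variables (delta : {linear C -> tprod C C}) (eps : C -> K).
Variables (mu : A -> A -> A) (e : A).
Variables L M R : C -> A.
Hypothesis deltaA : forall h,
  \tsum_(a, b <- delta h) (\tsum_(a1, a2 <- delta a) (a1 \ox (a2 \ox b))) =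
  \tsum_(a, b <- delta h) (a \ox delta b).
Hypothesis epsl : forall h, \tsum_(a, b <- delta h) (eps a *: b) = h.
Hypothesis epsr : forall h, \tsum_(a, b <- delta h) (eps b *: a) = h.
Hypothesis mul : forall b, linear (fun a => mu a b).
Hypothesis mur : forall a, linear (mu a).
Hypothesis muA : forall a b c, mu a (mu b c) = mu (mu a b) c.
Hypothesis mu1 : forall a, mu a e = a.
Hypothesis mu1l : forall a, mu e a = a.

Lemma conv_uniq : linear L -> linear M -> linear R ->
  (forall c, \tsum_(a, b <- delta c) mu (L a) (M b) = eps c *: e) ->
  (forall c, \tsum_(a, b <- delta c) mu (M a) (R b) = eps c *: e) -> L =1 R.
Proof.
move=> lL lM lR LM MR c.
transitivity (\tsum_(a, b <- delta c) (\tsum_(b1, b2 <- delta b) mu (L a) (mu (M b1) (R b2)))).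
  rewrite -{1}[c]epsr (tsum_sum _ _ lL); apply: eq_tsum => a b.
  rewrite -(tsum_sum _ _ (mur (L a))) MR.
  by rewrite -[L _]/(mklin lL _) linearZ -[mu _ _]/(mklin (mur _) _) linearZ /= mu1.
rewrite -(tsum3 (F := fun a b c => mu (L a) (mu (M b) (R c))) (deltaA c)); [|lin|lin|lin].
rewrite -[in RHS](epsl c) (tsum_sum _ _ lR); apply: eq_tsum => a b.
rewrite -[R (_ *: _)]/(mklin lR _) linearZ /= -[in RHS](mu1l (R b)).
rewrite -[mu e _]/(mklin (mul _) e) -linearZ /= -LM.
rewrite (tsum_sum _ _ (mul (R b))); apply: eq_tsum => x y.
by rewrite muA.
Qed.

End Convolution.

Section HopfTheory.
Variables (K : fieldType) (H : hopfAlg K).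
Local Notation S := (@antipode K H).
Local Notation D := (@comul K H).
Local Notation eps := (@counit K H).

Lemma coassoc (W : lmodType K) (F : H -> H -> H -> W) h :
  (forall b c, linear (fun a => F a b c)) -> (forall a c, linear (fun b => F a b c)) ->
  (forall a b, linear (F a b)) ->
  \tsum_(a, b <- D h) (\tsum_(c, d <- D a) F c d b) =
    \tsum_(a, b <- D h) (\tsum_(c, d <- D b) F a c d).
Proof. exact/tsum3/comulA. Qed.

Lemma counitlF (W : lmodType K) (F : H -> W) h :
  linear F -> \tsum_(a, b <- D h) (eps a *: F b) = F h.
Proof.
move=> lF; rewrite -[in RHS](counitl h) tsum_sum //; apply: eq_tsum => a b.
by rewrite -[RHS]/(mklin lF _) linearZ.
Qed.

Lemma counitrF (W : lmodType K) (F : H -> W) h :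
  linear F -> \tsum_(a, b <- D h) (eps b *: F a) = F h.
Proof.
move=> lF; rewrite -[in RHS](counitr h) tsum_sum //; apply: eq_tsum => a b.
by rewrite -[RHS]/(mklin lF _) linearZ.
Qed.

Lemma antipodelF (W : lmodType K) (F : H -> W) h :
  linear F -> \tsum_(a, b <- D h) F (S a * b) = eps h *: F 1.
Proof. by move=> lF; rewrite -tsum_sum // antipodel -[LHS]/(mklin lF _) linearZ. Qed.

Lemma antipoderF (W : lmodType K) (F : H -> W) h :
  linear F -> \tsum_(a, b <- D h) F (a * S b) = eps h *: F 1.
Proof. by move=> lF; rewrite -tsum_sum // antipoder -[LHS]/(mklin lF _) linearZ. Qed.

Lemma comulMF (W : lmodType K) (F : H -> H -> W) h k :
  (forall b, linear (F^~ b)) -> (forall a, linear (F a)) ->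
  tsum (D (h * k)) F = \tsum_(a, b <- D h) (\tsum_(c, d <- D k) F (a * c) (b * d)).
Proof.
move=> l1 l2; rewrite comulM (tsum_sum _ _ (tsum_lint l2)); apply: eq_tsum => a b.
rewrite (tsum_sum _ _ (tsum_lint l2)); apply: eq_tsum => c d.
by rewrite tsum_tensor.
Qed.

Lemma antipode1 : S 1 = 1.
Proof.
have := antipodel (1 : H); rewrite comul1 tsum_tensor; [|lin|lin].
by rewrite mulr1 rmorph1 scale1r.
Qed.

Definition tmul (s t : tprod H H) : tprod H H :=
  \tsum_(a, b <- s) (\tsum_(c, d <- t) ((a * c) \ox (b * d))).

Lemma tmull t : linear (fun s => tmul s t). Proof. rewrite /tmul; lin. Qed.
Lemma tmulr s : linear (tmul s). Proof. rewrite /tmul; lin. Qed.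

Lemma tmulE a b c d : tmul (a \ox b) (c \ox d) = (a * c) \ox (b * d).
Proof. by rewrite /tmul !tsum_tensor; lin. Qed.

Lemma tmulA s t u : tmul s (tmul t u) = tmul (tmul s t) u.
Proof.
have lr := tmulr; have ll := tmull.
move: s; apply: tensor_ind; [by lin|by lin|move=> a b].
move: t; apply: tensor_ind; [by lin|by lin|move=> c d].
move: u; apply: tensor_ind; [by lin|by lin|move=> f g].
by rewrite !tmulE !mulrA.
Qed.

Lemma tmul1 s : tmul s (1 \ox 1) = s.
Proof.
have lr := tmulr; have ll := tmull.
move: s; apply: tensor_ind; [by lin|by lin|move=> a b].
by rewrite !tmulE !mulr1.
Qed.

Lemma tmul1l s : tmul (1 \ox 1) s = s.
Proof.
have lr := tmulr; have ll := tmull.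
move: s; apply: tensor_ind; [by lin|by lin|move=> a b].
by rewrite !tmulE !mul1r.
Qed.

Lemma comulM' h k : D (h * k) = tmul (D h) (D k).
Proof. exact: comulM. Qed.

Definition tdelta_f (t : tprod H H) : tprod (tprod H H) (tprod H H) :=
  \tsum_(a, b <- t) (\tsum_(a1, a2 <- D a) (\tsum_(b1, b2 <- D b)
    ((a1 \ox b1) \ox (a2 \ox b2)))).
Lemma tdelta_lin : linear tdelta_f. Proof. rewrite /tdelta_f; lin. Qed.
Definition tdelta := mklin tdelta_lin.

Definition teps_f (t : tprod H H) : K := \tsum_(a, b <- t) (eps a *: (eps b : K^o)).
Lemma teps_lin : scalar teps_f.
Proof.
apply: (tsum_lint (W := K^o) (F := fun a b => eps a *: (eps b : K^o))) => c x u v.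
by rewrite [LHS](_ : _ = eps c * eps (x *: u + v)) // linearP mulrDr mulrCA.
Qed.
Definition teps := mkscal teps_lin.

Lemma tsum_tdelta (W : lmodType K) (F : tprod H H -> tprod H H -> W) a b :
  (forall b, linear (F^~ b)) -> (forall a, linear (F a)) ->
  tsum (tdelta (a \ox b)) F =
  \tsum_(a1, a2 <- D a) (\tsum_(b1, b2 <- D b) F (a1 \ox b1) (a2 \ox b2)).
Proof.
move=> l1 l2.
rewrite /tdelta /= /tdelta_f tsum_tensor; [|by lin|by lin].
rewrite (tsum_sum _ _ (tsum_lint l2)); apply: eq_tsum => c d.
rewrite (tsum_sum _ _ (tsum_lint l2)); apply: eq_tsum => c' d'.
by rewrite tsum_tensor.
Qed.

Lemma tepsE a b : teps (a \ox b) = eps a * eps b.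
Proof.
rewrite /teps /= /teps_f tsum_tensor // => c x u v.
  by rewrite linearP scalerDl scalerA.
by rewrite [LHS](_ : _ = eps c * eps (x *: u + v)) // linearP mulrDr mulrCA.
Qed.

Lemma tdeltaA h :
  \tsum_(a, b <- tdelta h) (\tsum_(a1, a2 <- tdelta a) (a1 \ox (a2 \ox b))) =
  \tsum_(a, b <- tdelta h) (a \ox tdelta b).
Proof.
move: h; apply: tensor_ind; [by lin|by lin|move=> x y].
rewrite !tsum_tdelta; [|by lin..].
transitivity (\tsum_(a, b <- D x) (\tsum_(c, d <- D a) (\tsum_(a', b' <- D y)
   (\tsum_(c', d' <- D a') ((c \ox c') \ox ((d \ox d') \ox (b \ox b'))))))).
  apply: eq_tsum => a b; rewrite tsum_exch; apply: eq_tsum => a' b'.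
  by rewrite tsum_tdelta; [|by lin..].
rewrite coassoc; [|by lin..].
apply: eq_tsum => a b.
transitivity (\tsum_(c, d <- D b) (\tsum_(a', b' <- D y) (\tsum_(c', d' <- D b')
    ((a \ox a') \ox ((c \ox c') \ox (d \ox d')))))).
  by apply: eq_tsum => c d; rewrite coassoc; lin.
rewrite tsum_exch; apply: eq_tsum => a' b'.
rewrite /tdelta /= /tdelta_f tsum_tensor; [|by lin..].
rewrite tsum_sum; [|by lin]; apply: eq_tsum => c d.
by rewrite tsum_sum; [|by lin].
Qed.

Lemma tepsl h : \tsum_(a, b <- tdelta h) (teps a *: b) = h.
Proof.
move: h; apply: tensor_ind; [by lin|by lin|move=> x y].
rewrite tsum_tdelta; [|by lin..].
rewrite -[RHS](counitlF (F := fun u => u \ox y)); [|by lin].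
apply: eq_tsum => a b; rewrite -[in RHS](counitlF (F := fun u => b \ox u)); [|by lin].
rewrite tsumZ.
by apply: eq_tsum => c d; rewrite tepsE scalerA.
Qed.

Lemma tepsr h : \tsum_(a, b <- tdelta h) (teps b *: a) = h.
Proof.
move: h; apply: tensor_ind; [by lin|by lin|move=> x y].
rewrite tsum_tdelta; [|by lin..].
rewrite -[RHS](counitrF (F := fun u => u \ox y)); [|by lin].
apply: eq_tsum => a b; rewrite -[in RHS](counitrF (F := fun u => a \ox u)); [|by lin].
rewrite tsumZ.
by apply: eq_tsum => c d; rewrite tepsE scalerA.
Qed.

Lemma antipodeM h k : S (h * k) = S k * S h.
Proof.
pose mm (F : H -> H -> H) (t : tprod H H) := tsum t F.
pose L := mm (fun a b => S (a * b)).
pose M := mm (fun a b => a * b).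
pose R := mm (fun a b => S b * S a).
have lL : linear L by rewrite /L /mm; lin.
have lM : linear M by rewrite /M /mm; lin.
have lR : linear R by rewrite /R /mm; lin.
have LE a b : L (a \ox b) = S (a * b) by rewrite /L /mm tsum_tensor; lin.
have ME a b : M (a \ox b) = a * b by rewrite /M /mm tsum_tensor; lin.
have RE a b : R (a \ox b) = S b * S a by rewrite /R /mm tsum_tensor; lin.
rewrite -LE -RE; move: (h \ox k).
apply: (conv_uniq (delta := tdelta) (eps := teps) (mu := *%R) (e := 1) (M := M)) => //.
- exact: tdeltaA.
- exact: tepsl.
- exact: tepsr.
- by lin.
- by lin.
- exact: mulrA.
- exact: mulr1.
- exact: mul1r.
- apply: tensor_ind; [by lin|by lin|move=> a b].
  rewrite tsum_tdelta; [|by lin..].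
  transitivity (\tsum_(c, d <- D (a * b)) (S c * d)).
    rewrite comulMF; [|by lin..]; apply: eq_tsum => a1 a2; apply: eq_tsum => b1 b2.
    by rewrite LE ME.
  by rewrite antipodel rmorphM tepsE.
- apply: tensor_ind; [by lin|by lin|move=> a b].
  rewrite tsum_tdelta; [|by lin..].
  rewrite tepsE mulrC -scalerA -antipoder tsumZ; apply: eq_tsum => a1 a2.
  transitivity (\tsum_(b1, b2 <- D b) (a1 * (b1 * S b2) * S a2)).
    by apply: eq_tsum => b1 b2; rewrite ME RE !mulrA.
  rewrite (antipoderF (F := fun x => a1 * x * S a2)); last by lin.
  by rewrite mulr1.
Qed.

Lemma comulS h : D (S h) = \tsum_(a, b <- D h) (S b \ox S a).
Proof.
have lr := tmulr; have ll := tmull.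
pose R h := \tsum_(a, b <- D h) (S b \ox S a).
move: h; apply: (conv_uniq (delta := D) (eps := eps) (mu := tmul)
  (e := 1 \ox 1) (M := D) (R := R)).
- exact: comulA.
- exact: counitl.
- exact: counitr.
- by lin.
- by lin.
- exact: tmulA.
- exact: tmul1.
- exact: tmul1l.
- by lin.
- by lin.
- by rewrite /R; lin.
- move=> h; rewrite -comul1 -antipodelF; last by lin.
  by apply: eq_tsum => a b; rewrite comulM'.
- move=> h.
  transitivity (\tsum_(a, b <- D h) (\tsum_(a1, a2 <- D a) (\tsum_(b1, b2 <- D b)
      ((a1 * S b2) \ox (a2 * S b1))))).
    apply: eq_tsum => a b; rewrite /tmul; apply: eq_tsum => a1 a2.
    rewrite tsum_nest; last by lin.
    by apply: eq_tsum => c d; rewrite tsum_tensor; lin.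
  rewrite coassoc; [|by lin..].
  transitivity (\tsum_(a, b <- D h) ((a * S b) \ox (1 : H))); last first.
    by rewrite (antipoderF (F := fun x => x \ox (1 : H))); last by lin.
  apply: eq_tsum => a b.
  rewrite -(coassoc (F := fun x y z => (a * S z) \ox (x * S y))); [|by lin..].
  rewrite -(counitlF (F := fun x => (a * S x) \ox (1 : H))); last by lin.
  apply: eq_tsum => c d.
  by rewrite (antipoderF (F := fun x => (a * S d) \ox x)); last by lin.
Qed.


End HopfTheory.

Section AntipodeInj.
Variables (K : fieldType) (H : hopfAlg K).
Local Notation S := (@antipode K H).
Local Notation D := (@comul K H).
Local Notation eps := (@counit K H).
Local Notation dual := ('Hom(H, K^o) : vectType K).

Definition ev (p : dual) (x : H) : K := p x.

Lemma ev_linl x : scalar (ev^~ x).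
Proof. by move=> a p q; rewrite /ev !lfunE /= lfunE. Qed.

Lemma ev_linr p : scalar (ev p).
Proof. by move=> a x y; rewrite /ev linearP. Qed.

Lemma lin_evl (T : lmodType K) (V : vectType K) (f : T -> dual) x (v : V) :
  linear f -> linear (fun t => ev (f t) x *: v).
Proof. by move=> lf a t u; rewrite lf ev_linl scalerDl scalerA. Qed.

Lemma lin_evr (T : lmodType K) (V : vectType K) (f : T -> H) p (v : V) :
  linear f -> linear (fun t => ev p (f t) *: v).
Proof. by move=> lf a t u; rewrite lf ev_linr scalerDl scalerA. Qed.

Ltac lin_hook ::= first [apply: lin_evl | apply: lin_evr].

Local Notation n := (\dim {:H}).
Local Notation e i := ((vbasis {:H})`_(i : 'I_n)).

Definition dbas (i : 'I_n) : dual := linfun (mklin (f := fun x : H => coord (vbasis {:H}) i x : K^o) (@linearP _ _ _ _ (coord (vbasis {:H}) i))).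

Lemma ev_dbas i x : ev (dbas i) x = coord (vbasis {:H}) i x.
Proof. by rewrite /ev lfunE. Qed.

Lemma dbasE (V : vectType K) (G : H -> V) x : linear G ->
  \sum_(i < n) ev (dbas i) x *: G (e i) = G x.
Proof.
move=> lG; rewrite [in RHS](coord_vbasis (memvf x)).
rewrite -[RHS]/(mklin lG _) linear_sum; apply: eq_bigr => i _.
by rewrite linearZ /= ev_dbas.
Qed.

Lemma dual_expand (p : dual) : p = \sum_(i < n) ev p (e i) *: dbas i.
Proof.
apply/lfunP => x.
rewrite [in LHS](coord_vbasis (memvf x)) linear_sum sum_lfunE; apply: eq_bigr => i _.
rewrite linearZ /= scale_lfunE -/(ev (dbas i) x) ev_dbas.
by rewrite [LHS]mulrC.
Qed.

Lemma dual_sep (V : vectType K) (t s : tprod dual V) :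
  (forall x, \tsum_(p, v <- t) (ev p x *: v) = \tsum_(p, v <- s) (ev p x *: v)) ->
  t = s.
Proof.
have E (u : tprod dual V) :
    u = \sum_(i < n) (dbas i \ox (\tsum_(p, v <- u) (ev p (e i) *: v))).
  move: u; apply: tensor_ind; first by lin.
    move=> a u v; rewrite scaler_sumr -big_split; apply: eq_bigr => i _ /=.
    have lt : linear (fun u : tprod dual V => dbas i \ox (\tsum_(p, v <- u) (ev p (e i) *: v))).
      by lin.
    by rewrite lt.
  move=> p v.
  have lt : linear (fun p : dual => p \ox v) by lin.
  rewrite {1}(dual_expand p) -[LHS]/(mklin lt _) linear_sum; apply: eq_bigr => i _.
  rewrite tsum_tensor; [|by lin..].
  have lv : linear (fun v : V => dbas i \ox v) by lin.
  by rewrite linearZ /= -[RHS]/(mklin lv _) linearZ.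
by move=> eq_ts; rewrite (E t) (E s); apply: eq_bigr => i _; rewrite eq_ts.
Qed.

(* The right H-comodule structure of H^*: f maps to the sum of the f_0 (x) f_1
   such that f_0(y) f_1 = y_1 f(y_2) for all y (rhoE). *)
Definition rho_f (f : dual) : tprod dual H :=
  \sum_(i < n) (dbas i \ox (\tsum_(a, b <- D (e i)) (ev f b *: a))).

Lemma rho_lin : linear rho_f.
Proof.
move=> a u v; rewrite scaler_sumr -big_split; apply: eq_bigr => i _ /=.
have lt : linear (fun f : dual => dbas i \ox (\tsum_(a, b <- D (e i)) (ev f b *: a))).
  by lin.
by rewrite lt.
Qed.
Definition rho := mklin rho_lin.

Lemma rhoE f y : \tsum_(p, q <- rho f) (ev p y *: q) = \tsum_(a, b <- D y) (ev f b *: a).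
Proof.
have lt : linear (fun t : tprod dual H => \tsum_(p, q <- t) (ev p y *: q)) by lin.
rewrite -[LHS]/(mklin lt (rho_f f)) /rho_f linear_sum.
rewrite -(dbasE (G := fun y => \tsum_(a, b <- D y) (ev f b *: a))); last by lin.
by apply: eq_bigr => i _; rewrite /= tsum_tensor; lin.
Qed.

Lemma rhoA f :
  \tsum_(p, q <- rho f) (\tsum_(p', q' <- rho p) (p' \ox (q' \ox q))) =
  \tsum_(p, q <- rho f) (p \ox D q).
Proof.
apply: dual_sep => x; rewrite tsum_nest; last by lin.
rewrite [RHS]tsum_nest; last by lin.
transitivity (\tsum_(p, q <- rho f) (\tsum_(a, b <- D x) (ev p b *: (a \ox q)))).
  apply: eq_tsum => p q; rewrite tsum_nest; last by lin.
  transitivity (\tsum_(p', q' <- rho p) (ev p' x *: (q' \ox q))).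
    by apply: eq_tsum => p' q'; rewrite tsum_tensor; lin.
  have lt : linear (fun y : H => y \ox q) by lin.
  transitivity (mklin lt (\tsum_(p', q' <- rho p) (ev p' x *: q'))).
    rewrite tsum_sum; last exact: linearP.
    by apply: eq_tsum => a b; rewrite linearZ.
  rewrite rhoE tsum_sum; last exact: linearP.
  by apply: eq_tsum => a b; rewrite linearZ.
transitivity (D (\tsum_(p, q <- rho f) (ev p x *: q))); last first.
  rewrite tsum_sum; last exact: linearP.
  by apply: eq_tsum => p q; rewrite linearZ tsum_tensor; lin.
rewrite rhoE tsum_exch tsum_sum; last exact: linearP.
transitivity (\tsum_(a, b <- D x) (\tsum_(a1, a2 <- D a) (ev f b *: (a1 \ox a2)))); last first.
  by apply: eq_tsum => a b; rewrite linearZ /= {2}(tsumE (D a)) tsumZ.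
rewrite coassoc; [|by lin..]; apply: eq_tsum => a b.
have lt : linear (fun y : H => a \ox y) by lin.
transitivity (mklin lt (\tsum_(p, q <- rho f) (ev p b *: q))).
  rewrite tsum_sum; last exact: linearP.
  by apply: eq_tsum => p q; rewrite linearZ.
rewrite rhoE tsum_sum; last exact: linearP.
by apply: eq_tsum => p q; rewrite linearZ.
Qed.

(* Projection onto the left integrals, from the fundamental theorem of Hopf
   modules applied to H^*. *)
Definition intproj (f : dual) (x : H) : K :=
  \tsum_(p, q <- rho f) (ev p (x * S (S q)) *: (1 : K^o)).

Lemma ev_hopf (f : dual) x m :
  \tsum_(a, b <- D x) (ev f (b * S m) *: a) =
  \tsum_(m1, m2 <- D m) (\tsum_(a, b <- D (x * S m1)) (ev f b *: (a * m2))).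
Proof.
transitivity (\tsum_(m1, m2 <- D m) (\tsum_(a, b <- D x) (\tsum_(c, d <- D m1)
   (ev f (b * S c) *: (a * (S d * m2)))))); last first.
  apply: eq_tsum => m1 m2; rewrite comulMF; [|by lin..].
  apply: eq_tsum => a b; rewrite comulS tsum_nest; last by lin.
  by apply: eq_tsum => c d; rewrite tsum_tensor ?mulrA; lin.
rewrite tsum_exch; apply: eq_tsum => a b.
rewrite coassoc; [|by lin..].
transitivity (\tsum_(m1, m2 <- D m) (eps m2 *: (ev f (b * S m1) *: (a * 1)))).
  rewrite (counitrF (F := fun x => ev f (b * S x) *: (a * 1))) ?mulr1 //; last by lin.
apply: eq_tsum => m1 m2.
by rewrite (antipodelF (F := fun x => ev f (b * S m1) *: (a * x))); last by lin.
Qed.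

Lemma rho3 (X : lmodType K) (F : dual -> H -> H -> X) f :
  (forall b c, linear (fun a => F a b c)) -> (forall a c, linear (fun b => F a b c)) ->
  (forall a b, linear (F a b)) ->
  \tsum_(p, q <- rho f) (\tsum_(p', q' <- rho p) F p' q' q) =
  \tsum_(p, q <- rho f) (\tsum_(q1, q2 <- D q) F p q1 q2).
Proof. exact/tsum3/rhoA. Qed.

Lemma intproj_int f x :
  \tsum_(a, b <- D x) (intproj f b *: a) = intproj f x *: 1.
Proof.
have scE (V : vectType K) (u : V) y :
    intproj f y *: u = \tsum_(p, q <- rho f) (ev p (y * S (S q)) *: u).
  have lt : linear (fun c : K^o => (c : K) *: u).
    by move=> a c d; rewrite scalerDl scalerA.
  rewrite -[LHS]/(mklin lt _) tsum_sum; last exact: linearP.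
  apply: eq_tsum => p q; rewrite linearZ /=.
  by rewrite scale1r.
transitivity (\tsum_(p, q <- rho f) (\tsum_(a, b <- D x) (ev p (b * S (S q)) *: a))).
  by rewrite tsum_exch; apply: eq_tsum => a b; rewrite scE.
rewrite scE.
transitivity (\tsum_(p, q <- rho f) (\tsum_(p', q' <- rho p) (\tsum_(q1, q2 <- D q)
    (ev p' (x * S (S q2)) *: (q' * S q1))))).
  apply: eq_tsum => p q; rewrite ev_hopf comulS tsum_nest; last by lin.
  rewrite tsum_exch; apply: eq_tsum => q1 q2.
  rewrite tsum_tensor; [|by lin..].
  have lt : linear (fun y : H => y * S q1) by lin.
  transitivity (mklin lt (\tsum_(a, b <- D (x * S (S q2))) (ev p b *: a))).
    rewrite tsum_sum; last exact: linearP.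
    by apply: eq_tsum => a b; rewrite linearZ /= scalerAl.
  rewrite -rhoE tsum_sum; last exact: linearP.
  by apply: eq_tsum => a b; rewrite linearZ /= scalerAl.
rewrite rho3; [|by lin..]; apply: eq_tsum => p q.
rewrite -(coassoc (F := fun a b c => ev p (x * S (S c)) *: (a * S b))); [|by lin..].
rewrite -(counitlF (F := fun a => ev p (x * S (S a)) *: (1 : H))); last by lin.
apply: eq_tsum => a b.
by rewrite (antipoderF (F := fun y => ev p (x * S (S b)) *: y)); last by lin.
Qed.

Lemma intproj_split f x :
  ev f x = \tsum_(p, q <- rho f) (intproj p (x * S q) : K^o) :> K^o.
Proof.
rewrite /intproj rho3; [|by lin..].
transitivity (\tsum_(p, q <- rho f) (eps q *: (ev p x *: (1 : K^o)))); last first.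
  apply: eq_tsum => p q.
  transitivity (\tsum_(q1, q2 <- D q) (ev p (x * S (S q1 * q2)) *: (1 : K^o))).
    rewrite (antipodelF (F := fun y => ev p (x * S y) *: (1 : K^o))); last by lin.
    by rewrite antipode1 mulr1.
  by apply: eq_tsum => a b; rewrite antipodeM mulrA.
have lt : linear (fun y : H => eps y *: (1 : K^o)) by lin.
transitivity (mklin lt (\tsum_(p, q <- rho f) (ev p x *: q))); last first.
  rewrite tsum_sum; last exact: linearP.
  by apply: eq_tsum => a b; rewrite linearZ /= !scalerA mulrC.
rewrite rhoE tsum_sum; last exact: linearP.
transitivity (\tsum_(a, b <- D x) (eps a *: (ev f b *: (1 : K^o)))).
  rewrite (counitlF (F := fun y => ev f y *: (1 : K^o))); last by lin.
  by rewrite [RHS]mulr1.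
by apply: eq_tsum => a b; rewrite [RHS]linearZ /= !scalerA mulrC.
Qed.

Lemma antipode_inj : injective S.
Proof.
suff inj0 h : S h = 0 -> h = 0.
  by move=> x y eq_S; apply/eqP; rewrite -subr_eq0; apply/eqP/inj0; rewrite linearB eq_S subrr.
move=> Sh0; apply/eqP; case: (eqVneq h 0) => // hn0.
suff int0 f x : intproj f x = 0.
  pose f : dual := linfun (mklin (f := fun x : H => eps x : K^o) (@linearP _ _ _ _ eps)).
  have := intproj_split f 1; rewrite {1}/ev lfunE /= rmorph1 => /eqP.
  rewrite [X in _ == X](_ : _ = 0) ?oner_eq0 //.
  by rewrite /tsum big1 // => i _; rewrite int0.
have li : scalar (intproj f).
  apply: (tsum_linF (W := K^o) (F := fun x p q => ev p (x * S (S q)) *: (1 : K^o))).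
  by lin.
pose lam m : dual := linfun (mklin (f := fun x => intproj f (x * S m) : K^o)
   (lin_comp (g := intproj f : H -> K^o) (f := fun x => x * S m) li
      (lin_ml _ (@lin_id _ _)))).
have lamE m y : ev (lam m) y = intproj f (y * S m) by rewrite /ev lfunE.
have llam : linear lam.
  move=> a u v; apply/lfunP => y; rewrite add_lfunE scale_lfunE.
  by rewrite -![lam _ _]/(ev _ _) !lamE linearP mulrDr -scalerAr li.
have tau0 : \tsum_(h1, h2 <- D h) (lam h1 \ox h2) = 0.
  apply: dual_sep => y; rewrite [RHS](_ : _ = 0); last first.
    by apply: (linear0 (mklin (tsum_lint (F := fun p v => ev p y *: v) _))); lin.
  rewrite tsum_nest; last by lin.
  pose f' : dual := linfun (mklin (f := fun x : H => intproj f x : K^o) li).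
  have f'E z : ev f' z = intproj f z by rewrite /ev lfunE.
  transitivity (\tsum_(a, b <- D y) (ev f' (b * S h) *: a)).
    rewrite ev_hopf; apply: eq_tsum => m1 m2.
    rewrite tsum_tensor; [|by lin..].
    have lt : linear (fun y : H => y * m2) by lin.
    transitivity (mklin lt (\tsum_(a, b <- D (y * S m1)) (intproj f b *: a))).
      by rewrite intproj_int linearZ /= mul1r lamE.
    rewrite tsum_sum; last exact: linearP.
    by apply: eq_tsum => a b; rewrite linearZ /= f'E.
  by rewrite /tsum big1 // => i _; rewrite Sh0 mulr0 [ev _ _]linear0 scale0r.
have : \tsum_(p, q <- \tsum_(h1, h2 <- D h) (lam h1 \ox h2))
    (\tsum_(q1, q2 <- D q) (ev p (x * S (S q1)) *: q2)) = 0.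
  rewrite tau0.
  by apply: (linear0 (mklin (tsum_lint (F := fun p q => \tsum_(q1, q2 <- D q) (ev p (x * S (S q1)) *: q2)) _))); lin.
rewrite tsum_nest; last by lin.
have lt (V : vectType K) (v : V) : linear (fun y => intproj f y *: v).
  by move=> a u w; rewrite li scalerDl scalerA.
suff -> : \tsum_(a, b <- D h) tsum (lam a \ox b) (fun p q => \tsum_(q1, q2 <- D q) (ev p (x * S (S q1)) *: q2))
    = intproj f x *: h.
  by move/eqP; rewrite scaler_eq0 (negPf hn0) orbF => /eqP.
transitivity (\tsum_(a, b <- D h) (\tsum_(b1, b2 <- D b) (intproj f (x * S (a * S b1)) *: b2))).
  apply: eq_tsum => a b; rewrite tsum_tensor; [|by lin..].
  by apply: eq_tsum => b1 b2; rewrite lamE antipodeM mulrA.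
have lt2 (T : lmodType K) (g : T -> H) (V : vectType K) (v : V) : linear g -> linear (fun y => intproj f (g y) *: v).
  by move=> lg a u w; rewrite lg li scalerDl scalerA.
rewrite -(coassoc (F := fun a b c => intproj f (x * S (a * S b)) *: c)); first last.
- by lin.
- by move=> a c; apply: lt2; lin.
- by move=> a c; apply: lt2; lin.
rewrite -(counitlF (F := fun y => intproj f x *: y)); last by lin.
apply: eq_tsum => a b.
rewrite (antipoderF (F := fun y => intproj f (x * S y) *: b)); last by apply: lt2; lin.
by rewrite antipode1 mulr1.
Qed.

End AntipodeInj.
Ltac lin_hook ::= fail.

Section AntipodeInverse.
Variables (K : fieldType) (H : hopfAlg K).
Local Notation S := (@antipode K H).
Local Notation D := (@comul K H).
Local Notation eps := (@counit K H).

(* The antipode of a finite-dimensional Hopf algebra is bijective, so this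
   inverse on the image is the two-sided inverse (antipodeK, antipodeVK). *)
Definition antipodeV : {linear H -> H} := (linfun S)^-1%VF.

Lemma lker_antipode : lker (linfun S) == 0%VS.
Proof. by apply/lker0P => x y; rewrite !lfunE; apply: antipode_inj. Qed.

Lemma antipodeK : cancel S antipodeV.
Proof. by move=> x; rewrite -[S x](lfunE S) /antipodeV /= lker0_lfunK ?lker_antipode. Qed.

Lemma antipodeVK : cancel antipodeV S.
Proof.
have Sbij : bijective S.
  exists (antipodeV) => // [|x]; first exact: antipodeK.
  rewrite -[S _](lfunE S) /antipodeV /= limg_lfunVK //.
  suff -> : limg (linfun S) = fullv by rewrite memvf.
  apply/eqP; rewrite eqEdim subvf /= limg_dim_eq // ?(eqP lker_antipode) ?capv0 //.
move=> x; have [T TK SK] := Sbij.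
by rewrite -{1}(SK x) antipodeK SK.
Qed.

Lemma antipodeV1 : antipodeV 1 = 1.
Proof. by rewrite -{1}(antipode1 H) antipodeK. Qed.

Lemma antipodeVM h k : antipodeV (h * k) = antipodeV k * antipodeV h.
Proof. by apply: (can_inj antipodeK); rewrite antipodeM !antipodeVK. Qed.

Lemma comulSV h : D (antipodeV h) = \tsum_(a, b <- D h) (antipodeV b \ox antipodeV a).
Proof.
rewrite -[in RHS](antipodeVK h) comulS tsum_nest; last by lin.
rewrite {1}(tsumE (D _)); apply: eq_tsum => a b.
by rewrite tsum_tensor ?antipodeK; lin.
Qed.

Lemma antipodeVl h : \tsum_(a, b <- D h) (antipodeV b * a) = (eps h)%:A.
Proof.
apply: (can_inj antipodeK); rewrite tsum_sum; last exact: linearP.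
rewrite linearZ /= antipode1 -antipodel; apply: eq_tsum => a b.
by rewrite antipodeM antipodeVK.
Qed.

Lemma antipodeVlF (W : lmodType K) (F : H -> W) h :
  linear F -> \tsum_(a, b <- D h) F (antipodeV b * a) = eps h *: F 1.
Proof. by move=> lF; rewrite -tsum_sum // antipodeVl -[LHS]/(mklin lF _) linearZ. Qed.

Lemma antipodeVr h : \tsum_(a, b <- D h) (b * antipodeV a) = (eps h)%:A.
Proof.
apply: (can_inj antipodeK); rewrite tsum_sum; last exact: linearP.
rewrite linearZ /= antipode1 -antipoder; apply: eq_tsum => a b.
by rewrite antipodeM antipodeVK.
Qed.

Lemma antipodeVrF (W : lmodType K) (F : H -> W) h :
  linear F -> \tsum_(a, b <- D h) F (b * antipodeV a) = eps h *: F 1.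
Proof. by move=> lF; rewrite -tsum_sum // antipodeVr -[LHS]/(mklin lF _) linearZ. Qed.

End AntipodeInverse.
Arguments antipodeV {K H}.

Record ydMod (K : fieldType) (H : hopfAlg K) := YdMod {
  yd_sort :> vectType K;
  yd_act : H -> yd_sort -> yd_sort;
  yd_coact : {linear yd_sort -> tprod yd_sort H};
  yd_act_linl : forall m, linear (yd_act^~ m);
  yd_act_linr : forall h, linear (yd_act h);
  yd_act1 : forall m, yd_act 1 m = m;
  yd_actM : forall h k m, yd_act (h * k) m = yd_act h (yd_act k m);
  yd_coactA : forall m,
    \tsum_(m0, m1 <- yd_coact m) (\tsum_(m00, m01 <- yd_coact m0)
      (m00 \ox (m01 \ox m1))) =
    \tsum_(m0, m1 <- yd_coact m) (m0 \ox comul m1);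
  yd_counit : forall m, \tsum_(m0, m1 <- yd_coact m) (counit m1 *: m0) = m;
  yd_compat : forall h m,
    \tsum_(h1, h2 <- comul h) (\tsum_(m0, m1 <- yd_coact m)
      (yd_act h1 m0 \ox (h2 * m1))) =
    \tsum_(h1, h2 <- comul h) (\tsum_(m0, m1 <- yd_coact (yd_act h2 m))
      (m0 \ox (m1 * h1)))
}.

Arguments yd_act {K H y} : rename.
Arguments yd_coact {K H y} : rename.

Notation "h \act m" := (yd_act h m) (at level 40) : ring_scope.

Section YdTheory.
Variables (K : fieldType) (H : hopfAlg K).
Local Notation D := (@comul K H).
Local Notation eps := (@counit K H).
Implicit Types M N : ydMod H.

Lemma lin_actl (T : lmodType K) M (f : T -> H) (m : M) :
  linear f -> linear (fun t => f t \act m).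
Proof. by move=> lf; apply: (lin_comp (@yd_act_linl _ _ M m) lf). Qed.

Lemma lin_actr (T : lmodType K) M (f : T -> M) (h : H) :
  linear f -> linear (fun t => h \act f t).
Proof. by move=> lf; apply: (lin_comp (@yd_act_linr _ _ M h) lf). Qed.

End YdTheory.
Ltac lin_hook ::= first [apply: lin_actl | apply: lin_actr].

Section YdTheory2.
Variables (K : fieldType) (H : hopfAlg K).
Local Notation D := (@comul K H).
Local Notation eps := (@counit K H).
Local Notation Sv := (@antipodeV K H).
Implicit Types M N : ydMod H.

Lemma yd_coactAF (X : lmodType K) M (F : M -> H -> H -> X) m :
  (forall b c, linear (fun a => F a b c)) -> (forall a c, linear (fun b => F a b c)) ->
  (forall a b, linear (F a b)) ->
  \tsum_(p, q <- yd_coact m) (\tsum_(p', q' <- yd_coact p) F p' q' q) =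
  \tsum_(p, q <- yd_coact m) (\tsum_(q1, q2 <- D q) F p q1 q2).
Proof. exact/tsum3/yd_coactA. Qed.

Lemma yd_counitF (W : lmodType K) M (F : M -> W) m :
  linear F -> \tsum_(a, b <- yd_coact m) (eps b *: F a) = F m.
Proof.
move=> lF; rewrite -[in RHS](yd_counit m) tsum_sum //; apply: eq_tsum => a b.
by rewrite -[RHS]/(mklin lF _) linearZ.
Qed.

Lemma yd_compatF (W : lmodType K) M (F : M -> H -> W) h m :
  (forall b, linear (F^~ b)) -> (forall a, linear (F a)) ->
  \tsum_(h1, h2 <- D h) (\tsum_(m0, m1 <- yd_coact m) F (h1 \act m0) (h2 * m1)) =
  \tsum_(h1, h2 <- D h) (\tsum_(m0, m1 <- yd_coact (h2 \act m)) F m0 (m1 * h1)).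
Proof.
move=> l1 l2.
transitivity (tsum (\tsum_(h1, h2 <- D h) (\tsum_(m0, m1 <- yd_coact m)
      ((h1 \act m0) \ox (h2 * m1)))) F).
  rewrite tsum_nest //; apply: eq_tsum => a b; rewrite tsum_nest //.
  by apply: eq_tsum => c d; rewrite tsum_tensor.
rewrite yd_compat tsum_nest //; apply: eq_tsum => a b; rewrite tsum_nest //.
by apply: eq_tsum => c d; rewrite tsum_tensor.
Qed.

Lemma yd_coact_act M h (m : M) :
  yd_coact (h \act m) = \tsum_(h1, u <- D h) (\tsum_(h2, h3 <- D u)
    (\tsum_(m0, m1 <- yd_coact m) ((h2 \act m0) \ox (h3 * m1 * Sv h1)))).
Proof.
transitivity (\tsum_(h1, u <- D h) (\tsum_(h2, h3 <- D u)
    (\tsum_(m0, m1 <- yd_coact (h3 \act m)) (m0 \ox (m1 * h2 * Sv h1))))); last first.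
  apply: eq_tsum => h1 u.
  by rewrite (yd_compatF (F := fun a b => a \ox (b * Sv h1))); lin.
rewrite -(coassoc (F := fun h1 h2 h3 =>
    \tsum_(m0, m1 <- yd_coact (h3 \act m)) (m0 \ox (m1 * h2 * Sv h1)))); [|by lin..].
rewrite -(counitlF (F := fun h => yd_coact (h \act m))); last by lin.
apply: eq_tsum => a b.
transitivity (\tsum_(c, d <- D a)
   (fun y => \tsum_(m0, m1 <- yd_coact (b \act m)) (m0 \ox (m1 * y))) (d * Sv c)).
  rewrite (antipodeVrF (F := fun y => \tsum_(m0, m1 <- yd_coact (b \act m)) (m0 \ox (m1 * y)))); last by lin.
  by congr (_ *: _); rewrite {1}(tsumE (yd_coact _)); apply: eq_tsum => c d; rewrite mulr1.
by apply: eq_tsum => c d; apply: eq_tsum => x y; rewrite mulrA.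
Qed.

End YdTheory2.

Section YdTensor.
Variables (K : fieldType) (H : hopfAlg K) (M N : ydMod H).
Local Notation D := (@comul K H).
Local Notation eps := (@counit K H).

Definition yd_tensor_act (h : H) (t : tprod M N) : tprod M N :=
  \tsum_(m, n <- t) (\tsum_(h1, h2 <- D h) ((h1 \act m) \ox (h2 \act n))).

Definition yd_tensor_coact_fun (t : tprod M N) : tprod (tprod M N) H :=
  \tsum_(m, n <- t) (\tsum_(m0, m1 <- yd_coact m) (\tsum_(n0, n1 <- yd_coact n)
    ((m0 \ox n0) \ox (n1 * m1)))).

Lemma yd_tensor_coact_linear : linear yd_tensor_coact_fun.
Proof. rewrite /yd_tensor_coact_fun; lin. Qed.

Definition yd_tensor_coact := mklin yd_tensor_coact_linear.

Lemma yd_tensor_act_linl t : linear (yd_tensor_act^~ t).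
Proof. rewrite /yd_tensor_act; lin. Qed.
Lemma yd_tensor_act_linr h : linear (yd_tensor_act h).
Proof. rewrite /yd_tensor_act; lin. Qed.

Lemma yd_tensor_actE h m n :
  yd_tensor_act h (m \ox n) = \tsum_(h1, h2 <- D h) ((h1 \act m) \ox (h2 \act n)).
Proof. by rewrite /yd_tensor_act tsum_tensor; lin. Qed.

Lemma yd_tensor_coactE m n :
  yd_tensor_coact (m \ox n) =
  \tsum_(m0, m1 <- yd_coact m) (\tsum_(n0, n1 <- yd_coact n)
    ((m0 \ox n0) \ox (n1 * m1))).
Proof. by rewrite /yd_tensor_coact /= /yd_tensor_coact_fun tsum_tensor; lin. Qed.

Lemma yd_tensor_coactEF (W : lmodType K) (F : tprod M N -> H -> W) m n :
  (forall b, linear (F^~ b)) -> (forall a, linear (F a)) ->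
  tsum (yd_tensor_coact (m \ox n)) F =
  \tsum_(m0, m1 <- yd_coact m) (\tsum_(n0, n1 <- yd_coact n)
    F (m0 \ox n0) (n1 * m1)).
Proof.
move=> l1 l2; rewrite yd_tensor_coactE tsum_nest //; apply: eq_tsum => a b.
by rewrite tsum_nest //; apply: eq_tsum => c d; rewrite tsum_tensor.
Qed.

Let ll := yd_tensor_act_linl.
Let lr := yd_tensor_act_linr.

Lemma yd_tensor_act1 t : yd_tensor_act 1 t = t.
Proof.
move: t; apply: tensor_ind; [exact: lr|by lin|move=> m n].
by rewrite yd_tensor_actE comul1 tsum_tensor ?yd_act1; lin.
Qed.

Lemma yd_tensor_actM h k t :
  yd_tensor_act (h * k) t = yd_tensor_act h (yd_tensor_act k t).
Proof.
have := lr; move=> lr'.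
move: t; apply: tensor_ind; [by lin|by lin|move=> m n].
rewrite !yd_tensor_actE comulMF; [|by lin..].
rewrite tsum_exch tsum_sum; last exact: lr.
apply: eq_tsum => a b; rewrite yd_tensor_actE.
by apply: eq_tsum => c d; rewrite !yd_actM.
Qed.

Lemma yd_tensor_coactA t :
  \tsum_(m0, m1 <- yd_tensor_coact t) (\tsum_(m00, m01 <- yd_tensor_coact m0)
      (m00 \ox (m01 \ox m1))) =
  \tsum_(m0, m1 <- yd_tensor_coact t) (m0 \ox comul m1).
Proof.
move: t; apply: tensor_ind; [by lin|by lin|move=> m n].
rewrite !yd_tensor_coactEF; [|by lin..].
transitivity (\tsum_(m0, m1 <- yd_coact m) (\tsum_(p, q <- yd_coact m0)
   (\tsum_(n0, n1 <- yd_coact n) (\tsum_(p', q' <- yd_coact n0)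
   ((p \ox p') \ox ((q' * q) \ox (n1 * m1))))))).
  apply: eq_tsum => a b; rewrite tsum_exch; apply: eq_tsum => c d.
  by rewrite yd_tensor_coactEF; lin.
rewrite yd_coactAF; [|by lin..]; apply: eq_tsum => m0 m1.
transitivity (\tsum_(m11, m12 <- D m1) (\tsum_(n0, n1 <- yd_coact n)
   (\tsum_(p', q' <- D n1) ((m0 \ox n0) \ox ((p' * m11) \ox (q' * m12)))))).
  by apply: eq_tsum => a b; rewrite yd_coactAF; lin.
rewrite tsum_exch; apply: eq_tsum => n0 n1.
rewrite comulM tsum_sum; last by lin.
rewrite tsum_exch; apply: eq_tsum => a b.
by rewrite tsum_sum; lin.
Qed.

Lemma yd_tensor_counit t :
  \tsum_(m0, m1 <- yd_tensor_coact t) (counit m1 *: m0) = t.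
Proof.
move: t; apply: tensor_ind; [by lin|by lin|move=> m n].
rewrite yd_tensor_coactEF; [|by lin..].
rewrite -[RHS](yd_counitF (F := fun u => u \ox n)); [|by lin].
apply: eq_tsum => a b; rewrite -[in RHS](yd_counitF (F := fun u => a \ox u)); [|by lin].
rewrite tsumZ; apply: eq_tsum => c d.
by rewrite rmorphM scalerA mulrC.
Qed.

Lemma yd_tensor_compat h t :
  \tsum_(h1, h2 <- comul h) (\tsum_(m0, m1 <- yd_tensor_coact t)
      (yd_tensor_act h1 m0 \ox (h2 * m1))) =
  \tsum_(h1, h2 <- comul h) (\tsum_(m0, m1 <- yd_tensor_coact (yd_tensor_act h2 t))
      (m0 \ox (m1 * h1))).
Proof.
have lr' := lr; have ll' := ll.
move: t; apply: tensor_ind; [by lin|by lin|move=> m n].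
transitivity (\tsum_(h1, u <- D h) (\tsum_(h2, h3 <- D u)
  (\tsum_(m0, m1 <- yd_coact m) (\tsum_(n0, n1 <- yd_coact n)
   (((h1 \act m0) \ox (h2 \act n0)) \ox (h3 * n1 * m1)))))).
  rewrite -(coassoc (F := fun h1 h2 h3 => \tsum_(m0, m1 <- yd_coact m)
    (\tsum_(n0, n1 <- yd_coact n)
    (((h1 \act m0) \ox (h2 \act n0)) \ox (h3 * n1 * m1))))); [|by lin..].
  apply: eq_tsum => a b; rewrite yd_tensor_coactEF; [|by lin..].
  rewrite [RHS]tsum_exch; apply: eq_tsum => m0 m1.
  rewrite [RHS]tsum_exch; apply: eq_tsum => n0 n1.
  rewrite yd_tensor_actE tsum_tl.
  by apply: eq_tsum => c d; rewrite mulrA.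
transitivity (\tsum_(h1, u <- D h) (\tsum_(h2, h3 <- D u)
  (\tsum_(m0, m1 <- yd_coact m) (\tsum_(n0, n1 <- yd_coact (h3 \act n))
   (((h1 \act m0) \ox n0) \ox (n1 * (h2 * m1))))))).
  apply: eq_tsum => h1 u; rewrite tsum_exch [RHS]tsum_exch; apply: eq_tsum => m0 m1.
  rewrite (yd_compatF (F := fun a b => ((h1 \act m0) \ox a) \ox (b * m1))); [|by lin..].
  by apply: eq_tsum => a b; apply: eq_tsum => c d; rewrite mulrA.
rewrite -(coassoc (F := fun h1 h2 h3 => \tsum_(m0, m1 <- yd_coact m)
  (\tsum_(n0, n1 <- yd_coact (h3 \act n))
   (((h1 \act m0) \ox n0) \ox (n1 * (h2 * m1)))))); [|by lin..].
transitivity (\tsum_(u, h3 <- D h) (\tsum_(h1, h2 <- D u)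
  (\tsum_(m0, m1 <- yd_coact (h2 \act m)) (\tsum_(n0, n1 <- yd_coact (h3 \act n))
   ((m0 \ox n0) \ox (n1 * (m1 * h1))))))).
  apply: eq_tsum => u h3.
  by rewrite (yd_compatF (F := fun a b => \tsum_(n0, n1 <- yd_coact (h3 \act n))
   ((a \ox n0) \ox (n1 * b)))); lin.
rewrite coassoc; [|by lin..]; apply: eq_tsum => h1 u.
rewrite yd_tensor_actE [yd_tensor_coact _]tsum_sum; last exact: linearP.
rewrite tsum_nest; last by lin.
apply: eq_tsum => a b; rewrite yd_tensor_coactEF; [|by lin..].
by apply: eq_tsum => c d; apply: eq_tsum => x y; rewrite mulrA.
Qed.

Definition yd_tensor : ydMod H := YdMod yd_tensor_act_linl yd_tensor_act_linr
  yd_tensor_act1 yd_tensor_actM yd_tensor_coactA yd_tensor_counit yd_tensor_compat.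

End YdTensor.

Section SubspaceTensor.
Variable K : fieldType.

Definition tensv (U V : vectType K) (A : {vspace U}) (B : {vspace V}) :
  {vspace tprod U V} := <<[seq u \ox v | u <- vbasis A, v <- vbasis B]>>%VS.

Lemma memv_tensv (U V : vectType K) (A : {vspace U}) (B : {vspace V}) u v :
  u \in A -> v \in B -> u \ox v \in tensv A B.
Proof.
move=> uA vB; rewrite (coord_vbasis uA).
have l1 : linear (fun x : U => x \ox v) by exact: tensor_linl.
rewrite -[_ \ox _]/(mklin l1 _) linear_sum memv_suml // => i _.
rewrite linearZ memvZ //= (coord_vbasis vB).
have l2 : linear (fun y : V => (vbasis A)`_i \ox y) by exact: tensor_linr.
rewrite -[_ \ox _]/(mklin l2 _) linear_sum memv_suml // => j _.
rewrite linearZ memvZ //= memv_span //.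
by apply/allpairsP; exists ((vbasis A)`_i, (vbasis B)`_j); rewrite !mem_nth ?size_tuple.
Qed.

Lemma tensv_ind (U V : vectType K) (A : {vspace U}) (B : {vspace V}) (W : lmodType K)
    (f g : tprod U V -> W) t : linear f -> linear g ->
  (forall a b, a \in A -> b \in B -> f (a \ox b) = g (a \ox b)) ->
  t \in tensv A B -> f t = g t.
Proof.
move=> lf lg fg.
move/(coord_span (X := in_tuple [seq u \ox v | u <- vbasis A, v <- vbasis B])) => ->.
rewrite -[f _]/(mklin lf _) -[g _]/(mklin lg _) !linear_sum.
apply: eq_bigr => i _; rewrite !linearZ /=; congr (_ *: _).
have : (in_tuple [seq u \ox v | u <- vbasis A, v <- vbasis B])`_i
    \in [seq u \ox v | u <- vbasis A, v <- vbasis B] by apply: mem_nth.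
case/allpairsP => [[u v] [uA vB ->]].
by apply: fg; apply: vbasis_mem.
Qed.

End SubspaceTensor.

Definition is_ydSub (K : fieldType) (H : hopfAlg K) (M : ydMod H) (W : {vspace M}) :=
  (forall h w, w \in W -> h \act w \in W) /\
  (forall w, w \in W -> yd_coact w \in tensv W fullv).

Section YdSub.
Variables (K : fieldType) (H : hopfAlg K) (M : ydMod H) (W : {vspace M}).
Hypothesis subW : is_ydSub W.
Local Notation D := (@comul K H).

Definition ydSub_act (h : H) (w : subvs_of W) : subvs_of W :=
  vsproj W (h \act vsval w).

Definition ydSub_coact_fun (w : subvs_of W) : tprod (subvs_of W) H :=
  \tsum_(m0, m1 <- yd_coact (vsval w)) (vsproj W m0 \ox m1).

Lemma ydSub_coact_linear : linear ydSub_coact_fun.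
Proof. rewrite /ydSub_coact_fun; lin. Qed.

Definition ydSub_coact := mklin ydSub_coact_linear.

Lemma ydSub_actE h w : vsval (ydSub_act h w) = h \act vsval w.
Proof. by apply: vsprojK; apply: subW.1; apply: subvsP. Qed.

Lemma ydSub_coactF (X : lmodType K) (F : M -> H -> X) w : (forall b, linear (F^~ b)) ->
  (forall a, linear (F a)) -> w \in W ->
  \tsum_(a, b <- yd_coact w) F (vsval (vsproj W a)) b = tsum (yd_coact w) F.
Proof.
move=> l1 l2 wW.
apply: (tensv_ind (f := fun t => \tsum_(a, b <- t) F (vsval (vsproj W a)) b)
  (g := fun t => tsum t F) _ _ _ (subW.2 w wW)); [by lin|by lin|].
move=> a b aW _; rewrite !tsum_tensor; [|by lin..].
by rewrite vsprojK.
Qed.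

Lemma ydSub_coactE (X : lmodType K) (F : subvs_of W -> H -> X) w :
  (forall b, linear (F^~ b)) -> (forall a, linear (F a)) ->
  tsum (ydSub_coact w) F = \tsum_(a, b <- yd_coact (vsval w)) F (vsproj W a) b.
Proof.
move=> l1 l2; rewrite /ydSub_coact /= /ydSub_coact_fun tsum_nest //.
by apply: eq_tsum => a b; rewrite tsum_tensor.
Qed.

Lemma ydSub_act_linl w : linear (ydSub_act^~ w).
Proof. rewrite /ydSub_act; lin. Qed.
Lemma ydSub_act_linr h : linear (ydSub_act h).
Proof. rewrite /ydSub_act; lin. Qed.

Lemma ydSub_act1 w : ydSub_act 1 w = w.
Proof. by rewrite /ydSub_act yd_act1 vsvalK. Qed.

Lemma ydSub_actM h k w : ydSub_act (h * k) w = ydSub_act h (ydSub_act k w).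
Proof. by rewrite {1}/ydSub_act yd_actM -ydSub_actE. Qed.

Lemma ydSub_coactA w :
  \tsum_(m0, m1 <- ydSub_coact w) (\tsum_(m00, m01 <- ydSub_coact m0)
      (m00 \ox (m01 \ox m1))) =
  \tsum_(m0, m1 <- ydSub_coact w) (m0 \ox D m1).
Proof.
rewrite !ydSub_coactE; [|by lin..].
transitivity (\tsum_(a, b <- yd_coact (vsval w))
    (\tsum_(c, d <- yd_coact (vsval (vsproj W a))) (vsproj W c \ox (d \ox b)))).
  by apply: eq_tsum => a b; rewrite ydSub_coactE; lin.
rewrite (ydSub_coactF (F := fun a b =>
  \tsum_(c, d <- yd_coact a) (vsproj W c \ox (d \ox b)))); [|by lin|by lin|exact: subvsP].
rewrite yd_coactAF; [|by lin..]; apply: eq_tsum => a b.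
by rewrite [in RHS](tsumE (D b)) [RHS](tsum_sum _ _ (tensor_linr _)).
Qed.

Lemma ydSub_counit w : \tsum_(m0, m1 <- ydSub_coact w) (counit m1 *: m0) = w.
Proof.
rewrite ydSub_coactE; [|by lin..].
by rewrite (yd_counitF (F := vsproj W)) ?vsvalK //; lin.
Qed.

Lemma ydSub_compat h w :
  \tsum_(h1, h2 <- D h) (\tsum_(m0, m1 <- ydSub_coact w)
      (ydSub_act h1 m0 \ox (h2 * m1))) =
  \tsum_(h1, h2 <- D h) (\tsum_(m0, m1 <- ydSub_coact (ydSub_act h2 w))
      (m0 \ox (m1 * h1))).
Proof.
have ll := ydSub_act_linl; have lr := ydSub_act_linr.
transitivity (\tsum_(h1, h2 <- D h) (\tsum_(m0, m1 <- yd_coact (vsval w))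
      (vsproj W (h1 \act m0) \ox (h2 * m1)))).
  apply: eq_tsum => h1 h2; rewrite ydSub_coactE; [|by lin..].
  by rewrite (ydSub_coactF (F := fun a b => vsproj W (h1 \act a) \ox (h2 * b)));
    [|by lin|by lin|exact: subvsP].
rewrite (yd_compatF (F := fun a b => vsproj W a \ox b)); [|by lin..].
apply: eq_tsum => h1 h2; rewrite ydSub_coactE; [|by lin..].
by rewrite ydSub_actE.
Qed.

Definition ydSub : ydMod H := YdMod ydSub_act_linl ydSub_act_linr
  ydSub_act1 ydSub_actM ydSub_coactA ydSub_counit ydSub_compat.

End YdSub.

Definition ydSimple (K : fieldType) (H : hopfAlg K) (M : ydMod H) :=
  (fullv : {vspace M}) != 0%VS /\
  forall W : {vspace M}, is_ydSub W -> W = 0%VS \/ W = fullv.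

Definition ydIso (K : fieldType) (H : hopfAlg K) (M N : ydMod H) :=
  exists f : {linear M -> N}, [/\ bijective f,
    forall h m, f (h \act m) = h \act f m &
    forall m, yd_coact (f m) = \tsum_(m0, m1 <- yd_coact m) (f m0 \ox m1)].

Definition grouplike (K : fieldType) (H : hopfAlg K) (g : H) :=
  comul g = g \ox g /\ counit g = 1.

Lemma grouplikeM (K : fieldType) (H : hopfAlg K) (g g' : H) :
  grouplike g -> grouplike g' -> grouplike (g * g').
Proof.
move=> [Dg eg] [Dg' eg']; split; last by rewrite rmorphM /= eg eg' mulr1.
by rewrite comulM Dg Dg' !tsum_tensor; lin.
Qed.

(* Elements of G(H^* ) are algebra maps H -> K, i.e. {lrmorphism H -> K | *%R};
   conv is the product of this group. *)
Section Characters.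
Variables (K : fieldType) (H : hopfAlg K).
Local Notation char := {lrmorphism H -> K | *%R}.

Definition conv_fun (b b' : char) (h : H) : K :=
  \tsum_(h1, h2 <- comul h) (b h1 * b' h2 : K^o).

Lemma conv_fun_scalar b b' : scalar (conv_fun b b').
Proof.
rewrite /conv_fun.
have l1 (x : K^o) : linear (fun h => b h * x : K^o).
  by move=> a u v; rewrite linearP mulrDl -mulrA.
have l2 (x : K^o) : linear (fun h => x * b' h : K^o).
  by move=> a u v; rewrite linearP mulrDr mulrCA.
by apply: (lin_tsum (F := fun h1 h2 => b h1 * b' h2 : K^o)); lin.
Qed.

Lemma conv_fun_monoid b b' : monoid_morphism (conv_fun b b').
Proof.
have l1 (x : K) : linear (fun h => b h * x : K^o).
  by move=> a u v; rewrite linearP mulrDl -mulrA.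
have l2 (x : K) : linear (fun h => x * b' h : K^o).
  by move=> a u v; rewrite linearP mulrDr mulrCA.
split; first by rewrite /conv_fun comul1 tsum_tensor // !rmorph1 mulr1.
move=> h k.
suff: conv_fun b b' (h * k) = conv_fun b b' h * conv_fun b b' k :> K^o by [].
have mr (c : K) (t : tprod H H) (F : H -> H -> K^o) :
    c * tsum t F = \tsum_(x, y <- t) (c * F x y : K^o) :> K^o by exact: mulr_sumr.
have ml (c : K) (t : tprod H H) (F : H -> H -> K^o) :
    tsum t F * c = \tsum_(x, y <- t) (F x y * c : K^o) :> K^o by exact: mulr_suml.
rewrite /conv_fun comulMF // ml; apply: eq_tsum => a c.
rewrite mr; apply: eq_tsum => x y.
by rewrite !rmorphM /= mulrACA.
Qed.

Definition conv (b b' : char) : char :=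
  HB.pack (conv_fun b b')
    (GRing.isLinear.Build K H K *%R (conv_fun b b') (conv_fun_scalar b b'))
    (GRing.isMonoidMorphism.Build H K (conv_fun b b') (conv_fun_monoid b b')).

End Characters.

Section Hbeta.
Variables (K : fieldType) (H : hopfAlg K) (b : {lrmorphism H -> K | *%R}).
Local Notation D := (@comul K H).
Local Notation Sv := (@antipodeV K H).

Definition Hb_act (h a : H) : H :=
  \tsum_(h1, u <- D h) (\tsum_(h2, h3 <- D u) (b h2 *: (h3 * a * Sv h1))).

Lemma Hb_act_linl a : linear (Hb_act^~ a).
Proof. rewrite /Hb_act; lin. Qed.
Lemma Hb_act_linr h : linear (Hb_act h).
Proof. rewrite /Hb_act; lin. Qed.

Lemma Hb_act1 a : Hb_act 1 a = a.
Proof.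
rewrite /Hb_act comul1 tsum_tensor; [|by lin..].
rewrite comul1 tsum_tensor; [|by lin..].
by rewrite rmorph1 scale1r antipodeV1 mulr1 mul1r.
Qed.

Lemma Hb_actM h k a : Hb_act (h * k) a = Hb_act h (Hb_act k a).
Proof.
rewrite /Hb_act comulMF; [|by lin..]; apply: eq_tsum => h1 u.
transitivity (\tsum_(k1, v <- D k) (\tsum_(h2, h3 <- D u) (\tsum_(k2, k3 <- D v)
  (b h2 *: (h3 * (b k2 *: (k3 * a * Sv k1)) * Sv h1))))).
  apply: eq_tsum => k1 v; rewrite comulMF; [|by lin..].
  apply: eq_tsum => h2 h3; apply: eq_tsum => k2 k3.
  rewrite rmorphM -scalerA -scalerAr -scalerAl antipodeVM.
  by rewrite !mulrA.
rewrite tsum_exch; apply: eq_tsum => h2 h3.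
rewrite (tsum_sum (g := fun y => b h2 *: (h3 * y * Sv h1))); last by lin.
apply: eq_tsum => k1 v.
by rewrite (tsum_sum (g := fun y => b h2 *: (h3 * y * Sv h1))); last by lin.
Qed.

Lemma Hb_compat h a :
  \tsum_(h1, h2 <- D h) (\tsum_(a1, a2 <- D a) (Hb_act h1 a1 \ox (h2 * a2))) =
  \tsum_(h1, h2 <- D h) (\tsum_(m0, m1 <- D (Hb_act h2 a)) (m0 \ox (m1 * h1))).
Proof.
transitivity (\tsum_(x, u <- D h) (\tsum_(y, z <- D u) (\tsum_(z1, z2 <- D z)
  (\tsum_(a1, a2 <- D a) (b y *: ((z1 * a1 * Sv x) \ox (z2 * a2))))))).
  transitivity (\tsum_(h1, h2 <- D h) (\tsum_(x, u <- D h1) (\tsum_(y, z <- D u)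
     (\tsum_(a1, a2 <- D a) (b y *: ((z * a1 * Sv x) \ox (h2 * a2))))))).
    apply: eq_tsum => h1 h2.
    transitivity (\tsum_(a1, a2 <- D a) (\tsum_(x, u <- D h1) (\tsum_(y, z <- D u)
       (b y *: ((z * a1 * Sv x) \ox (h2 * a2)))))).
      apply: eq_tsum => a1 a2; rewrite /Hb_act tsum_tl; apply: eq_tsum => x u.
      rewrite tsum_tl; apply: eq_tsum => y z.
      have lt : linear (fun t : H => t \ox (h2 * a2)) by lin.
      by rewrite -[LHS]/(mklin lt _) linearZ.
    rewrite tsum_exch; apply: eq_tsum => x u.
    by rewrite tsum_exch.
  rewrite coassoc; [|by lin..]; apply: eq_tsum => x v.
  by rewrite coassoc; lin.
transitivity (\tsum_(h1, w <- D h) (\tsum_(x, u <- D w) (\tsum_(x1, x2 <- D x)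
  (\tsum_(y, z <- D u) (\tsum_(z1, z2 <- D z)
  (\tsum_(a1, a2 <- D a) (b y *: ((z1 * a1 * Sv x2) \ox (z2 * a2 * (Sv x1 * h1)))))))))).
  transitivity (\tsum_(h1, w <- D h) (\tsum_(x1, v <- D w) (\tsum_(x2, u <- D v)
    (\tsum_(y, z <- D u) (\tsum_(z1, z2 <- D z)
    (\tsum_(a1, a2 <- D a) (b y *: ((z1 * a1 * Sv x2) \ox (z2 * a2 * (Sv x1 * h1)))))))))); last first.
    by apply: eq_tsum => h1 w; rewrite coassoc; lin.
  rewrite -(coassoc (F := fun h1 x1 v => \tsum_(x2, u <- D v)
    (\tsum_(y, z <- D u) (\tsum_(z1, z2 <- D z)
    (\tsum_(a1, a2 <- D a) (b y *: ((z1 * a1 * Sv x2) \ox (z2 * a2 * (Sv x1 * h1))))))))); [|by lin..].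
  rewrite -(counitlF (F := fun v => \tsum_(x2, u <- D v)
    (\tsum_(y, z <- D u) (\tsum_(z1, z2 <- D z)
    (\tsum_(a1, a2 <- D a) (b y *: ((z1 * a1 * Sv x2) \ox (z2 * a2)))))))); last by lin.
  apply: eq_tsum => p v.
  rewrite (antipodeVlF (F := fun q => \tsum_(x2, u <- D v)
    (\tsum_(y, z <- D u) (\tsum_(z1, z2 <- D z)
    (\tsum_(a1, a2 <- D a) (b y *: ((z1 * a1 * Sv x2) \ox (z2 * a2 * q)))))))); last by lin.
  congr (_ *: _).
  apply: eq_tsum => ? ?; apply: eq_tsum => ? ?; apply: eq_tsum => ? ?.
  by apply: eq_tsum => ? ?; rewrite mulr1.
apply: eq_tsum => h1 w.
rewrite [D (Hb_act w a)]tsum_sum; last exact: linearP.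
rewrite tsum_nest; last by lin.
apply: eq_tsum => x u.
rewrite [D (tsum _ _)]tsum_sum; last exact: linearP.
rewrite tsum_nest; last by lin.
rewrite tsum_exch; apply: eq_tsum => y z.
have lt : linear (fun t : tprod H H => \tsum_(m0, m1 <- t) (m0 \ox (m1 * h1 : H))) by lin.
rewrite linearZ -[RHS]/(mklin lt _) linearZ /=.
rewrite comulMF; [|by lin..]; rewrite comulMF; [|by lin..].
rewrite [LHS]tsum_exch tsumZ; apply: eq_tsum => z1 z2.
rewrite [LHS]tsum_exch tsumZ; apply: eq_tsum => a1 a2.
rewrite comulSV tsum_nest; last by lin.
rewrite tsumZ; apply: eq_tsum => x1 x2.
rewrite tsum_tensor; [|by lin..].
by rewrite !mulrA.
Qed.

(* Hb b is H_beta for beta = b, and Hbg b g below is its submodule generated by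
   the grouplike element g, i.e. the set of all Hb_act b h g. *)
Definition Hb : ydMod H := @YdMod K H H Hb_act comul Hb_act_linl Hb_act_linr
  Hb_act1 Hb_actM (@comulA K H) (@counitr K H) Hb_compat.

Variable g : H.
Hypothesis gg : grouplike g.

Definition Hbg_space : {vspace Hb} := limg (linfun (mklin (Hb_act_linl g))).

Lemma Hbg_spaceP (a : Hb) : reflect (exists h : H, a = Hb_act h g) (a \in Hbg_space).
Proof.
apply: (iffP memv_imgP) => [[h _ ->]|[h ->]]; exists h; rewrite ?memvf ?lfunE //.
Qed.

Lemma Hbg_is_ydSub : is_ydSub Hbg_space.
Proof.
split=> [h w /Hbg_spaceP[k ->]|w /Hbg_spaceP[k ->]].
  by apply/Hbg_spaceP; exists (h * k); rewrite Hb_actM.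
have -> : yd_coact (Hb_act k g : Hb) = yd_coact (yd_act k (g : Hb)) by [].
rewrite yd_coact_act; apply: memv_suml => i _; apply: memv_suml => j _.
have [Dg _] := gg; rewrite {1}/yd_coact /= Dg tsum_tensor; [|by lin..].
apply: memv_tensv; last exact: memvf.
by apply/Hbg_spaceP; eexists.
Qed.

Definition Hbg : ydMod H := ydSub Hbg_is_ydSub.

End Hbeta.

Section Graded.
Variables (K : fieldType) (H : hopfAlg K) (Hn : nat -> {vspace H}).

(* The first two clauses say that H is the internal direct sum of the Hn n over
   all n : nat. *)
Definition graded_hopf :=
  [/\ (forall n, directv (\sum_(i < n) Hn i)%VS),
      (forall h, exists n, h \in (\sum_(i < n) Hn i)%VS),
      1 \in Hn 0 /\ (forall m n, (Hn m * Hn n <= Hn (m + n)%N)%VS),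
      (forall n h, h \in Hn n ->
         comul h \in (\sum_(i < n.+1) tensv (Hn i) (Hn (n - i)%N))%VS) /\
      (forall n h, (0 < n)%N -> h \in Hn n -> counit h = 0) &
      forall n h, h \in Hn n -> antipode h \in Hn n].

(* iota identifies the subspace A with the group algebra K G. *)
Definition is_group_algebra (gT : finGroupType) (G : {group gT}) (iota : gT -> H)
    (A : {vspace H}) :=
  [/\ {in G &, forall x y, iota (x * y)%g = iota x * iota y},
      {in G, forall x, grouplike (iota x)} &
      basis_of A [seq iota x | x in G]].

End Graded.

(* Main.v *)
Require Import Defs.
From mathcomp Require Import all_boot all_order all_algebra all_fingroup all_field.

Set Implicit Arguments.
Unset Strict Implicit.
Unset Printing Implicit Defensive.

Import GRing.Theory.
Local Open Scope ring_scope.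

(** The isomorphism is multiplication. For every Hopf algebra H with bijective
antipode, [x \ox y |-> y * x] is a homomorphism of Yetter-Drinfel'd modules from
[H_beta (x) H_beta'] to [H_(beta beta')]: it is colinear because the coaction of
each side multiplies the second legs in the order [y_2 x_2], and it is linear
because, in [(h_2 . y)(h_1 . x)], the factor [S^-1(h_4)] ending the action on y
cancels the factor [h_3] starting the action on x ([Hb_act_conv]). Conceptually,
[H_beta] is coinduced from the character beta, homomorphisms into it correspond to
H-linear functionals into [K_beta] by composition with the counit, and the map above
corresponds to the functional [counit (x) counit].

Now restrict it to the tensor product T of the two given submodules. The vector
[g \ox g'] spans a subcomodule of T, so it generates a Yetter-Drinfel'd submodule,
which is T by simplicity ([ydSimple_cyclic]); hence the image is generated by the
product [g' * g], which is nonzero because its counit is 1. The kernel is a proper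
submodule, hence zero ([ydHom_simple_inj]). So T is isomorphic to the submodule
generated by [g' * g].

It remains to see that g and g' commute, and this is what the grading is for: a
group-like element has degree zero, since its top component in degree d would
contribute a nonzero square in bidegree (d, d), while the comultiplication preserves
the total degree ([grouplike_deg0]); and the degree zero part is the group algebra
of an abelian group. *)

(** * Tensors and subspaces *)

Section TensorSubspaces.
Variable K : fieldType.
Implicit Types U V W X : vectType K.

Lemma linear_map0 (U V : lmodType K) (f : U -> V) : linear f -> f 0 = 0.
Proof. by move=> lf; apply: (linear0 (mklin lf)). Qed.

Lemma tensor_square_eq0 U (u : U) : u \ox u = 0 -> u = 0.
Proof.
move=> uu0; apply/eqP; apply: contraT => u_neq0.
suff: u = 0 by move/eqP; rewrite (negPf u_neq0).
rewrite (coord_vbasis (memvf u)) big1 // => i _.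
have := congr1 (fun t : {ffun _ -> U} => t i) uu0.
rewrite !ffunE => /eqP; rewrite scaler_eq0 (negPf u_neq0) orbF => /eqP ->.
exact: scale0r.
Qed.

(** The kernel of [f (x) id] is [ker f (x) V]: with [h] a linear map such that
[f o h o f = f], the map [id - h o f] has values in [ker f], and it may be applied to
the left leg of t without changing t when [f (x) id] kills t. *)
Lemma tensv_lker U V W (f : {linear U -> W}) (t : tprod U V) :
  \tsum_(a, b <- t) (f a \ox b) = 0 -> t \in tensv (lker (linfun f)) fullv.
Proof.
set g := linfun f; move=> ft0.
pose q a := a - (g^-1)%VF (g a).
have ker_q a : q a \in lker g.
  by rewrite memv_ker linearB /= limg_lfunVK ?subrr ?memv_img ?memvf.
have back0 : \tsum_(a, b <- t) ((g^-1)%VF (g a) \ox b) = 0.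
  pose back (s : tprod W V) := \tsum_(c, b <- s) ((g^-1)%VF c \ox b).
  have lback : linear back by rewrite /back; lin.
  transitivity (back (\tsum_(a, b <- t) (f a \ox b))).
    rewrite tsum_sum //; apply: eq_tsum => a b.
    by rewrite /back tsum_tensor ?lfunE //; lin.
  by rewrite ft0; apply: (linear_map0 lback).
have -> : t = \tsum_(a, b <- t) (q a \ox b).
  rewrite -[RHS]addr0 -back0 {1}(tsumE t) /tsum -big_split; apply: eq_bigr => i _ /=.
  have lt := tensor_linl (U := U) (t i).
  have := lt 1 (q (vbasis fullv)`_i) ((g^-1)%VF (g (vbasis fullv)`_i)).
  by rewrite !scale1r => <-; rewrite /q subrK.
by apply: memv_suml => i _; apply: memv_tensv; rewrite ?memvf.
Qed.

Lemma tensv_kill U V W X (A : {vspace U}) (B : {vspace V})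
    (p : {linear U -> W}) (q : {linear V -> X}) t :
    t \in tensv A B ->
    (forall a, a \in A -> p a = 0) \/ (forall b, b \in B -> q b = 0) ->
  \tsum_(a, b <- t) (p a \ox q b) = 0.
Proof.
move=> tAB pq0.
pose f (t : tprod U V) := \tsum_(a, b <- t) (p a \ox q b).
have lf : linear f by rewrite /f; lin.
have l0 : linear (fun _ : tprod U V => 0 : tprod W X).
  by move=> a x y; rewrite scaler0 addr0.
apply: (tensv_ind lf l0 _ tAB) => a b aA bB.
rewrite /f tsum_tensor; [|by lin..].
case: pq0 => [p0|q0].
  by rewrite p0 //; apply: (linear_map0 (tensor_linl _)).
by rewrite q0 //; apply: (linear_map0 (tensor_linr _)).
Qed.

End TensorSubspaces.

(** * Group-like elements of a graded Hopf algebra *)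

Section GradedGrouplikes.
Variables (K : fieldType) (H : hopfAlg K) (Hn : nat -> {vspace H}).
Hypothesis gradedH : graded_hopf Hn.

(** The degree of a group-like element can be lowered as long as it is positive.
Let p be a projection that kills exactly the elements of degree at most d. In
[D x], where x has degree at most d + 1, every term has a leg of degree at most d,
as [2 (d + 1) > d + 1]. So [p (x) p] kills [D x = x \ox x], that is, [p x = 0]. *)
Lemma grouplike_lower_degree (x : H) d : grouplike x ->
  x \in (\sum_(i < d.+2) Hn i)%VS -> x \in (\sum_(i < d.+1) Hn i)%VS.
Proof.
have [_ _ _ [gr_comul _] _] := gradedH.
move=> [Dx _] x_le; set V := (\sum_(i < d.+1) Hn i)%VS.
pose p := (\1 - projv V)%VF.
have pE y : p y = y - projv V y by rewrite add_lfunE opp_lfunE id_lfunE.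
suff: p x = 0 by rewrite pE => /eqP; rewrite subr_eq0 => /eqP->; apply: memv_proj.
apply: tensor_square_eq0.
have p0 i a : (i < d.+1)%N -> a \in Hn i -> p a = 0.
  move=> lt_id aH; rewrite pE projv_id ?subrr //.
  by apply: subvP aH; apply: (sumv_sup (Ordinal lt_id)).
pose pp (t : tprod H H) := \tsum_(a, b <- t) (p a \ox p b).
have lpp : linear pp by rewrite /pp; lin.
have <- : pp (comul x) = p x \ox p x by rewrite Dx /pp tsum_tensor; lin.
have [y yH ->] := memv_sumP x_le.
rewrite linear_sum -[pp _]/(mklin lpp _) linear_sum big1 // => n _ /=.
have /memv_sumP[t tH ->] := gr_comul n (y n) (yH n isT).
rewrite -[pp _]/(mklin lpp _) linear_sum big1 // => i _ /=.
apply: (tensv_kill (tH i isT)).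
have [lt_id | ge_id] := ltnP i d.+1; first by left=> a; apply: p0.
right=> b; apply: p0; rewrite ltnS (leq_trans (leq_sub2l _ ge_id)) // leq_subLR.
have n_le : (n <= d.+1)%N by rewrite -ltnS.
exact: leq_trans n_le (leq_addr _ _).
Qed.

Lemma grouplike_deg0 (x : H) : grouplike x -> x \in Hn 0%N.
Proof.
have [_ exhaust _ _ _] := gradedH; move=> x_gl.
have [[|n]] := exhaust x.
  rewrite big_ord0 memv0 => /eqP x0; have [_] := x_gl.
  by rewrite x0 linear0 => /esym/eqP; rewrite oner_eq0.
elim: n => [|n IHn]; first by rewrite big_ord_recl big_ord0 addv0.
by move/grouplike_lower_degree => /(_ x_gl)/IHn.
Qed.

End GradedGrouplikes.

Lemma group_algebra_mulC (K : fieldType) (H : hopfAlg K) (gT : finGroupType)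
    (G : {group gT}) (iota : gT -> H) (A : {vspace H}) :
  abelian G -> is_group_algebra G iota A -> {in A &, commutative *%R}.
Proof.
move=> /centsP abelG [iotaM _ /andP[/eqP spanA _]] x y xA yA.
suff sub z : z \in A -> (A <= 'C[z])%VS by apply/cent1vP; apply: (subvP (sub y yA)).
have gen_comm u v : u \in G -> v \in G -> iota u * iota v = iota v * iota u.
  by move=> uG vG; rewrite -!iotaM // abelG.
have sub_gen u : u \in G -> (A <= 'C[iota u])%VS.
  move=> uG; rewrite -spanA; apply/span_subvP=> _ /imageP[v vG ->].
  by apply/cent1vP; apply: gen_comm.
move=> zA; rewrite -spanA; apply/span_subvP=> _ /imageP[v vG ->].
by rewrite cent1vC; apply: (subvP (sub_gen v vG)).
Qed.

(** * Homomorphisms of Yetter-Drinfel'd modules *)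

Section YdHom.
Variables (K : fieldType) (H : hopfAlg K).
Implicit Types M N : ydMod H.

Definition ydHom M N (f : {linear M -> N}) :=
  (forall h m, f (h \act m) = h \act f m) /\
  (forall m, yd_coact (f m) = \tsum_(m0, m1 <- yd_coact m) (f m0 \ox m1)).

Lemma ydSub_val_hom M (W : {vspace M}) (subW : is_ydSub W) :
  ydHom (vsval : {linear ydSub subW -> M}).
Proof.
split=> [h w|w]; first exact: (ydSub_actE subW).
rewrite (ydSub_coactE (F := fun a b => vsval a \ox b)); [|by lin..].
rewrite (ydSub_coactF subW (F := fun a b => a \ox b)); [|by lin..|exact: subvsP].
exact: tsumE.
Qed.

Lemma ydHom_corestrict M N (f : {linear M -> N}) (W : {vspace N})
    (subW : is_ydSub W) (fW : forall m, f m \in W) : ydHom f ->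
  ydHom (vsproj W \o f : {linear M -> ydSub subW}).
Proof.
move=> [f_act f_coact]; split=> [h m|m] /=.
  by apply/val_inj; rewrite /= f_act !vsprojK // -?f_act.
rewrite {1}/yd_coact /= /ydSub_coact_fun vsprojK // f_coact.
rewrite tsum_nest; last by lin.
by apply: eq_tsum => a b; rewrite tsum_tensor; lin.
Qed.

(** Subcomodules are recognised by [tensv_lker]: the coaction of an element of the
kernel is killed by [f (x) id]. *)
Lemma ydHom_ker M N (f : {linear M -> N}) : ydHom f -> is_ydSub (lker (linfun f)).
Proof.
move=> [f_act f_coact]; split=> [h w|w]; rewrite !memv_ker !lfunE /= => /eqP fw0.
  by rewrite f_act fw0 (linear_map0 (yd_act_linr h)).
by apply: tensv_lker; rewrite -f_coact fw0 linear0.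
Qed.

(** The orbit is a subcomodule because the Yetter-Drinfel'd condition determines
the coaction of [h . m] from that of m ([yd_coact_act]): its left leg is
[h_2 . m_0], again in the orbit when the coaction of m is [m \ox x]. *)
Lemma cyclic_is_ydSub M (m : M) (x : H) : yd_coact m = m \ox x ->
  is_ydSub (limg (linfun (mklin (yd_act_linl m)))).
Proof.
have orbit h : h \act m \in limg (linfun (mklin (yd_act_linl m))).
  by apply/memv_imgP; exists h; rewrite ?memvf ?lfunE.
move=> m_x; split=> [h _ /memv_imgP[k _ ->]|_ /memv_imgP[k _ ->]]; rewrite lfunE /=.
  by rewrite -yd_actM.
rewrite yd_coact_act; apply: memv_suml => i _; apply: memv_suml => j _.
rewrite m_x tsum_tensor; [|by lin..].
by apply: memv_tensv; rewrite ?memvf.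
Qed.

Lemma ydSimple_cyclic M (m : M) (x : H) : ydSimple M -> m != 0 ->
  yd_coact m = m \ox x -> forall u, exists h, u = h \act m.
Proof.
move=> [_ simpleM] m_neq0 m_x u.
have [W0|Wfull] := simpleM _ (cyclic_is_ydSub m_x).
  case/negP: m_neq0; rewrite -memv0 -W0; apply/memv_imgP; exists 1.
    exact: memvf.
  by rewrite lfunE /= yd_act1.
have := memvf u; rewrite -Wfull => /memv_imgP[h _ ->].
by exists h; rewrite lfunE.
Qed.

(** The injective half of Schur's lemma. *)
Lemma ydHom_simple_inj M N (f : {linear M -> N}) (m : M) :
  ydSimple M -> ydHom f -> f m != 0 -> injective f.
Proof.
move=> [_ simpleM] /ydHom_ker/simpleM[ker0|ker1] fm_neq0.
  have /lker0P inj : lker (linfun f) == 0%VS by rewrite ker0.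
  by move=> u v fuv; apply: inj; rewrite !lfunE.
case/negP: fm_neq0; have := memvf m.
by rewrite -ker1 memv_ker lfunE.
Qed.

Lemma ydHom_bij_iso M N (f : {linear M -> N}) :
  ydHom f -> injective f -> (forall v, exists u, v = f u) -> ydIso M N.
Proof.
move=> [f_act f_coact] f_inj f_surj; exists f; split=> //.
have ker0 : lker (linfun f) == 0%VS.
  by apply/lker0P => u v; rewrite !lfunE; apply: f_inj.
exists (linfun f)^-1%VF => [u|v].
  by rewrite -[f u](lfunE f) lker0_lfunK.
by have [u ->] := f_surj v; rewrite -[f u](lfunE f) lker0_lfunK ?lfunE.
Qed.

End YdHom.

(** * The multiplication map into [H_(beta beta')] *)

Section Product.
Variables (K : fieldType) (H : hopfAlg K) (b b' : {lrmorphism H -> K | *%R}).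
Local Notation D := (@comul K H).
Local Notation Sv := (@antipodeV K H).

(** With h split into six factors, the left side is
[beta(h_2) beta'(h_5) h_6 y S^-1(h_4) h_3 x S^-1(h_1)]; the two middle factors
collapse to the counit, and [beta(h_2) beta'(h_3)] is then the convolution
product. *)
Lemma Hb_act_conv (h x y : H) :
  \tsum_(p, q <- D h) (Hb_act b' q y * Hb_act b p x) = Hb_act (conv b b') h (y * x).
Proof.
(* Both sides are brought to this form, in which b and b' are evaluated on
   separate factors. *)
transitivity (\tsum_(h1, u <- D h) (\tsum_(h2, v <- D u) (\tsum_(h5, h6 <- D v)
    (b h2 *: (b' h5 *: (h6 * y * x * Sv h1)))))); last first.
  apply: eq_tsum => h1 u; rewrite -coassoc; [|by lin..].
  apply: eq_tsum => c d.
  have ls (w : H) : linear (fun k : K^o => (k : K) *: w).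
    by move=> k s t; rewrite scalerDl scalerA.
  rewrite [RHS](tsum_sum (g := fun k : K^o => (k : K) *: _)); last exact: ls.
  by apply: eq_tsum => h2 h5; rewrite scalerA !mulrA.
transitivity (\tsum_(p, q <- D h) (\tsum_(h1, u <- D p) (\tsum_(h2, h3 <- D u)
    (\tsum_(h4, v <- D q) (\tsum_(h5, h6 <- D v)
    (b h2 *: (b' h5 *: (h6 * y * (Sv h4 * h3) * x * Sv h1)))))))).
  apply: eq_tsum => p q; rewrite /Hb_act.
  rewrite (tsum_sum (g := fun z => _ * z)); last by lin.
  apply: eq_tsum => h1 u; rewrite (tsum_sum (g := fun z => _ * z)); last by lin.
  apply: eq_tsum => h2 h3; rewrite (tsum_sum (g := fun z => z * _)); last by lin.
  apply: eq_tsum => h4 v; rewrite (tsum_sum (g := fun z => z * _)); last by lin.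
  by apply: eq_tsum => h5 h6; rewrite -scalerAr -scalerAl !mulrA.
(* Coassociativity brings h3 and h4 next to each other, so that they cancel. *)
rewrite coassoc; [|by lin..]; apply: eq_tsum => h1 r.
rewrite coassoc; [|by lin..]; apply: eq_tsum => h2 s.
rewrite -(coassoc (F := fun h3 h4 v => \tsum_(h5, h6 <- D v)
    (b h2 *: (b' h5 *: (h6 * y * (Sv h4 * h3) * x * Sv h1))))); [|by lin..].
rewrite -(counitlF (F := fun v => \tsum_(h5, h6 <- D v)
    (b h2 *: (b' h5 *: (h6 * y * x * Sv h1))))); last by lin.
apply: eq_tsum => k v.
rewrite (antipodeVlF (F := fun z => \tsum_(h5, h6 <- D v)
    (b h2 *: (b' h5 *: (h6 * y * z * x * Sv h1))))); last by lin.
by congr (_ *: _); apply: eq_tsum => h5 h6; rewrite mulr1.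
Qed.

Variables (M N : ydMod H) (f : {linear M -> Hb b}) (f' : {linear N -> Hb b'}).

(** The product reverses the tensor factors because the coaction of a tensor
product of Yetter-Drinfel'd modules does. The maps f and f' allow the factors to be
submodules of [H_beta] and [H_beta']. *)
Definition Hb_prod_fun (t : yd_tensor M N) : Hb (conv b b') :=
  \tsum_(m, n <- t) ((f' n : H) * (f m : H)).

Lemma Hb_prod_linear : linear Hb_prod_fun.
Proof.
rewrite /Hb_prod_fun; apply: tsum_lint => m.
by apply: (lin_comp (g := fun z : H => z * (f m : H))); lin.
Qed.

Definition Hb_prod : {linear yd_tensor M N -> Hb (conv b b')} :=
  mklin Hb_prod_linear.

Lemma Hb_prodE m n : Hb_prod (m \ox n) = (f' n : H) * (f m : H).
Proof.
rewrite /Hb_prod /= /Hb_prod_fun tsum_tensor // => [k|k].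
  by apply: (lin_comp (g := fun z : H => (f' k : H) * z)); lin.
by apply: (lin_comp (g := fun z : H => z * (f k : H))); lin.
Qed.

Lemma Hb_prod_hom : ydHom f -> ydHom f' -> ydHom Hb_prod.
Proof.
move=> [f_act f_coact] [f'_act f'_coact]; split=> [h|].
  apply: tensor_ind; [by lin|by lin|move=> m n].
  transitivity (Hb_prod (\tsum_(p, q <- D h) ((p \act m) \ox (q \act n)))).
    by congr (Hb_prod _); apply: yd_tensor_actE.
  transitivity (Hb_act (conv b b') h ((f' n : H) * (f m : H))).
    rewrite tsum_sum; last exact: linearP.
    rewrite -Hb_act_conv; apply: eq_tsum => p q.
    by rewrite Hb_prodE f_act f'_act.
  by rewrite Hb_prodE.
apply: tensor_ind; [by lin|by lin|move=> m n].
rewrite [RHS]yd_tensor_coactEF; [|by lin..].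
transitivity (\tsum_(m0, m1 <- yd_coact (f m)) (\tsum_(n0, n1 <- yd_coact (f' n))
    (((n0 : H) * (m0 : H) : Hb (conv b b')) \ox (n1 * m1)))).
  by rewrite Hb_prodE /= comulM tsum_exch.
rewrite f_coact tsum_nest; last by lin.
apply: eq_tsum => m0 m1; rewrite tsum_tensor; [|by lin..].
rewrite f'_coact tsum_nest; last by lin.
apply: eq_tsum => n0 n1; rewrite tsum_tensor; [|by lin..].
by rewrite Hb_prodE.
Qed.

End Product.

Lemma Hbg_gen (K : fieldType) (H : hopfAlg K) (b : {lrmorphism H -> K | *%R})
    (g : H) : g \in Hbg_space b g.
Proof. by apply/Hbg_spaceP; exists 1; rewrite Hb_act1. Qed.

Theorem proposition1p5 (K : closedFieldType) (charK : [pchar K] =i pred0)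
    (H : hopfAlg K) (Hn : nat -> {vspace H}) (gradedH : graded_hopf Hn)
    (gT : finGroupType) (G : {group gT}) (iota : gT -> H)
    (abelG : abelian G) (H0_KG : is_group_algebra G iota (Hn 0%N))
    (beta beta' : {lrmorphism H -> K | *%R})
    (g g' : H) (g_gl : grouplike g) (g'_gl : grouplike g') :
  ydSimple (yd_tensor (Hbg beta g_gl) (Hbg beta' g'_gl)) ->
  ydIso (yd_tensor (Hbg beta g_gl) (Hbg beta' g'_gl))
        (Hbg (conv beta beta') (grouplikeM g_gl g'_gl)).
Proof.
move=> simpleT.
have gg'C : g' * g = g * g'.
  by apply: (group_algebra_mulC abelG H0_KG); apply: grouplike_deg0.
pose M := Hbg beta g_gl; pose N := Hbg beta' g'_gl.
pose m : M := vsproj (Hbg_space beta g) g.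
pose n : N := vsproj (Hbg_space beta' g') g'.
have mE : vsval m = g by rewrite vsprojK // Hbg_gen.
have nE : vsval n = g' by rewrite vsprojK // Hbg_gen.
have coact_gen (b : {lrmorphism H -> K | *%R}) x (x_gl : grouplike x) :
    let v : Hbg b x_gl := vsproj (Hbg_space b x) x in yd_coact v = v \ox x.
  rewrite /= /ydSub_coact_fun vsprojK ?Hbg_gen //.
  by have [/= -> _] := x_gl; rewrite tsum_tensor; lin.
pose F := Hb_prod (vsval : {linear M -> Hb beta}) (vsval : {linear N -> Hb beta'}).
have homF : ydHom F by apply: Hb_prod_hom; apply: ydSub_val_hom.
pose mn : yd_tensor M N := m \ox n.
have Fmn : F mn = g * g'.
  rewrite [LHS]Hb_prodE -gg'C.
  exact: (congr2 (fun x y : H => x * y) nE mE).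
have Fmn0 : F mn != 0.
  have [_ e1] := grouplikeM g_gl g'_gl; rewrite Fmn.
  by apply/eqP => gg0; have /eqP := e1; rewrite gg0 linear0 eq_sym oner_eq0.
have mn_coact : yd_coact mn = mn \ox (g' * g).
  rewrite [LHS]yd_tensor_coactE !coact_gen.
  by rewrite tsum_tensor; [rewrite tsum_tensor; lin|lin|lin].
have mn0 : mn != 0 by apply: contraNneq Fmn0 => ->; rewrite linear0.
have gen := ydSimple_cyclic simpleT mn0 mn_coact.
have FW t : F t \in Hbg_space (conv beta beta') (g * g').
  by have [h ->] := gen t; rewrite homF.1 Fmn; apply/Hbg_spaceP; exists h.
have homR := ydHom_corestrict (Hbg_is_ydSub (conv beta beta') (grouplikeM g_gl g'_gl))
  FW homF.
apply: (ydHom_bij_iso homR) => [|v].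
  apply: (ydHom_simple_inj (m := mn) simpleT homR).
  apply: contra Fmn0 => /eqP/(congr1 vsval).
  by rewrite /= (vsprojK (FW mn)) => F0; apply/eqP.
have /Hbg_spaceP[h vE] := subvsP v; exists (h \act mn); apply/val_inj.
by rewrite /= (vsprojK (FW _)) [RHS]homF.1 Fmn vE.
Qed.
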